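(* Let $H$ be a projective Hopf algebra, and assume that the right $H$-comodule algebras $A$ and $B$ are $H$-Galois extensions of $A^{{\rm co}H}$ and $B^{{\rm co}H}$, respectively. If $(T,U)$ is a pair of $H$-colinear inverse equivalences between the categories ${}_A\underline{\mathcal{M}}^H$ and ${}_B\underline{\mathcal{M}}^H$, then there exists a strict $H$-Morita context $(A,B,M,N,\alpha,\beta)$ such that $T\cong N\otimes_A-$ and $U\cong M\otimes_B-$.
   Context: $k$ is a commutative ring, and $H$ is a Hopf algebra over $k$ with bijective antipode $S$; ''projective'' means projective as a $k$-module. Write $\otimes=\otimes_k$, $\Delta(h)=h_{(1)}\otimes h_{(2)}$, and $\rho(m)=m_{[0]}\otimes m_{[1]}$ for right $H$-coactions; $M^{{\rm co}H}=\{m\in M\mid\rho(m)=m\otimes1\}$. A right $H$-comodule algebra $A$ is an $H$-Galois extension of $A^{{\rm co}H}$ if the canonical map ${\rm can}:A\otimes_{A^{{\rm co}H}}A\to A\otimes H$, ${\rm can}(a\otimes b)=ab_{[0]}\otimes b_{[1]}$, is bijective. ${}_A\mathcal{M}^H$ is the category of relative Hopf modules: left $A$-modules and right $H$-comodules $M$ with $\rho(am)=a_{[0]}m_{[0]}\otimes a_{[1]}m_{[1]}$, with left $A$-linear right $H$-colinear maps as morphisms. For $M,N\in{}_A\mathcal{M}^H$, ${}_A{\rm HOM}(M,N)$ is the set of left $A$-linear maps $f:M\to N$ for which there is a (necessarily unique) element $f_{[0]}\otimes f_{[1]}\in{}_A{\rm Hom}(M,N)\otimes H$ with $f_{[0]}(m)\otimes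 f_{[1]}=f(m_{[0]})_{[0]}\otimes S^{-1}(m_{[1]})f(m_{[0]})_{[1]}$ for all $m\in M$; it is a right $H$-comodule via $\rho(f)=f_{[0]}\otimes f_{[1]}$. The category ${}_A\underline{\mathcal{M}}^H$ has the same objects as ${}_A\mathcal{M}^H$, and the set of morphisms from $M$ to $N$ is ${}_A{\rm HOM}(M,N)$. ${}_B\underline{\mathcal{M}}^H$ is defined similarly. A functor $T:{}_A\underline{\mathcal{M}}^H\to{}_B\underline{\mathcal{M}}^H$ is $H$-colinear if for all objects $V,W$ the map ${}_A{\rm HOM}(V,W)\to{}_B{\rm HOM}(T(V),T(W))$, $f\mapsto T(f)$, is right $H$-colinear (and similarly with $A$ and $B$ interchanged). A pair of $H$-colinear inverse equivalences $(T,U)$ is a pair of inverse equivalences $T:{}_A\underline{\mathcal{M}}^H\to{}_B\underline{\mathcal{M}}^H$, $U:{}_B\underline{\mathcal{M}}^H\to{}_A\underline{\mathcal{M}}^H$ with both functors $H$-colinear. ${}_A\mathcal{M}_B^H$ is the category of $(A,B)$-bimodules with a right $H$-coaction satisfying $\rho(amb)=a_{[0]}m_{[0]}b_{[0]}\otimes a_{[1]}m_{[1]}b_{[1]}$, with left $A$-linear, right $B$-linear, right $H$-colinear maps. Tensor products $M\otimes_BN$ carry the coaction $\rho(m\otimes_Bn)=m_{[0]}\otimes_Bn_{[0]}\otimes m_{[1]}n_{[1]}$. An $H$-Morita context $(A,B,M,N,\alpha,\beta)$ connecting $A$ and $B$ is a Morita context with $M\in{}_A\mathcal{M}_B^H$,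 $N\in{}_B\mathcal{M}_A^H$, $\alpha:M\otimes_BN\to A$ a morphism in ${}_A\mathcal{M}_A^H$ and $\beta:N\otimes_AM\to B$ a morphism in ${}_B\mathcal{M}_B^H$ (so $\alpha(m\otimes n)m'=m\beta(n\otimes m')$ and $\beta(n\otimes m)n'=n\alpha(m\otimes n')$); it is strict if $\alpha$ and $\beta$ are isomorphisms. *)

(* Defs.v *)
From HB Require Import structures.
From mathcomp Require Import all_boot all_algebra.
From mathcomp Require Import boolp classical_sets functions.

Set Implicit Arguments.
Unset Strict Implicit.
Unset Printing Implicit Defensive.

Import GRing.Theory.
Local Open Scope ring_scope.
Local Open Scope quotient_scope.

(* The library's [algType] excludes the zero ring; here an algebra is a possibly
   zero ring A with a central ring morphism k -> A. *)
Record kalg (k : comPzRingType) := Kalg {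
  kalg_ring : pzRingType;
  kalg_map : {rmorphism k -> kalg_ring};
  kalg_mapC : forall c x, kalg_map c * x = x * kalg_map c
}.
Definition kalg_sort (k : comPzRingType) (A : kalg k) : Type := kalg_ring A.
Coercion kalg_sort : kalg >-> Sortclass.

Section KalgModule.
Variables (k : comPzRingType) (A : kalg k).
HB.instance Definition _ := GRing.PzRing.copy A (kalg_ring A).

Let kalg_scale (c : k) (x : A) : A := (kalg_map A c : A) * x.
Let kalg_scaleA c d x : kalg_scale c (kalg_scale d x) = kalg_scale (c * d) x.
Proof.
rewrite /kalg_scale mulrA; congr (_ * x).
by symmetry; exact: (rmorphM (kalg_map A)).
Qed.
Let kalg_scale1 : left_id 1 kalg_scale.
Proof. by move=> x; rewrite /kalg_scale (rmorph1 (kalg_map A)) mul1r. Qed.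
Let kalg_scaleDr : right_distributive kalg_scale +%R.
Proof. by move=> c x y; rewrite /kalg_scale mulrDr. Qed.
Let kalg_scaleDl x : {morph kalg_scale^~ x : c d / c + d}.
Proof. by move=> c d; rewrite /kalg_scale (rmorphD (kalg_map A)) mulrDl. Qed.
HB.instance Definition _ := GRing.Zmodule_isLmodule.Build k A
  kalg_scaleA kalg_scale1 kalg_scaleDr kalg_scaleDl.

Lemma kalg_scalerAl (c : k) (x y : A) : c *: (x * y) = (c *: x) * y.
Proof. exact: mulrA. Qed.
Lemma kalg_scalerAr (c : k) (x y : A) : c *: (x * y) = x * (c *: y).
Proof.
rewrite kalg_scalerAl [RHS]mulrA; congr (_ * y).
exact: kalg_mapC.
Qed.
End KalgModule.

Section Linear.
Variable k : comPzRingType.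

Definition mklin (M N : lmodType k) (f : M -> N) of linear f := f.
HB.instance Definition _ (M N : lmodType k) (f : M -> N) (hf : linear f) :=
  GRing.isLinear.Build k M N *:%R (mklin hf) hf.

Lemma scal_subproof (M : lmodType k) (c : k) : linear (fun m : M => c *: m).
Proof. by move=> a x y; rewrite scalerDr !scalerA mulrC. Qed.
Definition scal (M : lmodType k) (c : k) : {linear M -> M} :=
  mklin (@scal_subproof M c).

Variable A : kalg k.
Lemma lmul_subproof (a : A) : linear (fun x : A => a * x).
Proof. by move=> c x y; rewrite mulrDr kalg_scalerAr. Qed.
Lemma rmul_subproof (a : A) : linear (fun x : A => x * a).
Proof. by move=> c x y; rewrite mulrDl kalg_scalerAl. Qed.
Definition lmul (a : A) : {linear A -> A} := mklin (lmul_subproof a).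
Definition rmul (a : A) : {linear A -> A} := mklin (rmul_subproof a).
End Linear.

(* The tensor product of M and N balanced over R, where ra is a right action
   of R on M and la a left action of R on N, is the set of formal sums
   \sum_i m_i (x) n_i modulo the usual relations. *)
Section Tensor.
Variables (k : comPzRingType) (R : Type) (M N : lmodType k).
Variables (ra : R -> {linear M -> M}) (la : R -> {linear N -> N}).

Inductive tens_rel : seq (M * N) -> seq (M * N) -> Prop :=
| tens_refl s : tens_rel s s
| tens_sym s t : tens_rel s t -> tens_rel t s
| tens_trans s t u : tens_rel s t -> tens_rel t u -> tens_rel s u
| tens_cat s s' t t' :
    tens_rel s s' -> tens_rel t t' -> tens_rel (s ++ t) (s' ++ t')
| tens_comm s t : tens_rel (s ++ t) (t ++ s)
| tens_zero n : tens_rel [:: (0, n)] [::]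
| tens_addl m m' n : tens_rel [:: (m + m', n)] [:: (m, n); (m', n)]
| tens_addr m n n' : tens_rel [:: (m, n + n')] [:: (m, n); (m, n')]
| tens_scal (c : k) m n : tens_rel [:: (c *: m, n)] [:: (m, c *: n)]
| tens_bal r m n : tens_rel [:: (ra r m, n)] [:: (m, la r n)].

Definition tens_relb (s t : seq (M * N)) : bool := `[< tens_rel s t >].

Lemma tens_relb_refl : reflexive tens_relb.
Proof. by move=> s; apply/asboolP/tens_refl. Qed.
Lemma tens_relb_sym : symmetric tens_relb.
Proof. by move=> s t; apply: asbool_equiv_eq; split; apply: tens_sym. Qed.
Lemma tens_relb_trans : transitive tens_relb.
Proof.
by move=> t s u /asboolP st /asboolP tu; apply/asboolP/(tens_trans st tu).
Qed.

Canonical tens_equiv :=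
  EquivRel tens_relb tens_relb_refl tens_relb_sym tens_relb_trans.

Definition tens := {eq_quot tens_equiv}.
HB.instance Definition _ := Choice.on tens.
HB.instance Definition _ := EqQuotient.on tens.

Lemma tens_piP (s t : seq (M * N)) :
  tens_rel s t <-> \pi_tens s = \pi_tens t.
Proof.
split=> [st|/eqmodP /asboolP//]; apply/eqmodP; exact/asboolP.
Qed.

Lemma tens_reprK s : tens_rel (repr (\pi_tens s)) s.
Proof. by apply/tens_piP; rewrite reprK. Qed.

Definition tpure (m : M) (n : N) : tens := \pi [:: (m, n)].

Definition tens_add (x y : tens) : tens := \pi_tens (repr x ++ repr y).
Definition tens_mulc (c : k) (x : tens) : tens :=
  \pi_tens [seq (c *: p.1, p.2) | p <- repr x].

Lemma tens_pi_add s t : tens_add (\pi_tens s) (\pi_tens t) = \pi_tens (s ++ t).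
Proof. by apply/tens_piP/tens_cat; exact: tens_reprK. Qed.

Lemma tens_map_rel c s t : tens_rel s t ->
  tens_rel [seq (c *: p.1, p.2) | p <- s] [seq (c *: p.1, p.2) | p <- t].
Proof.
elim=> {s t} /=.
- by move=> s; exact: tens_refl.
- by move=> s t _ ?; exact: tens_sym.
- by move=> s t u _ st _ tu; exact: tens_trans st tu.
- by move=> s s' t t' _ ss _ tt; rewrite !map_cat; exact: tens_cat.
- by move=> s t; rewrite !map_cat; exact: tens_comm.
- by move=> n; rewrite scaler0; exact: tens_zero.
- by move=> m m' n; rewrite scalerDr; exact: tens_addl.
- by move=> m n n'; exact: tens_addr.
- by move=> d m n; rewrite scalerA mulrC -scalerA; exact: tens_scal.
- by move=> r m n; rewrite -linearZ; exact: tens_bal.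
Qed.

Lemma tens_pi_mulc c s :
  tens_mulc c (\pi_tens s) = \pi_tens [seq (c *: p.1, p.2) | p <- s].
Proof. by apply/tens_piP/tens_map_rel; exact: tens_reprK. Qed.

Lemma tens_addA : associative tens_add.
Proof.
elim/quotW=> s; elim/quotW=> t; elim/quotW=> u.
by rewrite (tens_pi_add t u) (tens_pi_add s t) !tens_pi_add catA.
Qed.
Lemma tens_addC : commutative tens_add.
Proof.
elim/quotW=> s; elim/quotW=> t; rewrite !tens_pi_add.
by apply/tens_piP/tens_comm.
Qed.
Lemma tens_add0 : left_id (\pi_tens [::]) tens_add.
Proof. by elim/quotW=> s; rewrite tens_pi_add. Qed.

Lemma tens_addACA a b c d :
  tens_add (tens_add a b) (tens_add c d) =
  tens_add (tens_add a c) (tens_add b d).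
Proof.
rewrite -(tens_addA a b) (tens_addA b c) (tens_addC b c).
by rewrite -(tens_addA c b) (tens_addA a c).
Qed.

Lemma tens_pi_cons p s :
  \pi_tens (p :: s) = tens_add (\pi_tens [:: p]) (\pi_tens s).
Proof. by rewrite tens_pi_add. Qed.

Lemma tens_addl_pi m m' n :
  \pi_tens [:: (m + m', n)] = tens_add (\pi [:: (m, n)]) (\pi [:: (m', n)]).
Proof. by rewrite tens_pi_add; apply/tens_piP/tens_addl. Qed.

Lemma tens_mulcDl (c d : k) x :
  tens_mulc (c + d) x = tens_add (tens_mulc c x) (tens_mulc d x).
Proof.
elim/quotW: x => s; rewrite !tens_pi_mulc.
elim: s => [|[m n] s IH] /=; first by rewrite tens_pi_add.
rewrite 3![\pi_tens (_ :: map _ _)]tens_pi_cons IH scalerDl tens_addl_pi.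
exact: tens_addACA.
Qed.

Lemma tens_mulc0 x : tens_mulc 0 x = \pi_tens [::].
Proof.
elim/quotW: x => s; rewrite tens_pi_mulc.
elim: s => [//|[m n] s IH] /=.
rewrite tens_pi_cons IH scale0r tens_addC tens_add0.
by apply/tens_piP/tens_zero.
Qed.

Lemma tens_mulc1 : left_id 1 tens_mulc.
Proof.
elim/quotW=> s; rewrite tens_pi_mulc; congr \pi_ _.
by elim: s => //= -[m n] s ->; rewrite scale1r.
Qed.

Lemma tens_mulcA (c d : k) x : tens_mulc c (tens_mulc d x) = tens_mulc (c * d) x.
Proof.
elim/quotW: x => s; rewrite (tens_pi_mulc d) !tens_pi_mulc -map_comp; congr \pi_ _.
by apply: eq_map => p /=; rewrite scalerA.
Qed.

Lemma tens_mulcDr : right_distributive tens_mulc tens_add.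
Proof.
move=> c; elim/quotW=> s; elim/quotW=> t.
rewrite (tens_pi_add s t) !tens_pi_mulc map_cat.
by rewrite (tens_pi_add [seq _ | _ <- s]).
Qed.

Definition tens_opp := tens_mulc (-1).
Lemma tens_addN : left_inverse (\pi_tens [::]) tens_opp tens_add.
Proof.
by move=> x; rewrite -{2}[x]tens_mulc1 -tens_mulcDl addNr tens_mulc0.
Qed.

HB.instance Definition _ :=
  GRing.isZmodule.Build tens tens_addA tens_addC tens_add0 tens_addN.
HB.instance Definition _ :=
  GRing.Zmodule_isLmodule.Build k tens tens_mulcA tens_mulc1 tens_mulcDr
    (fun x c d => tens_mulcDl c d x).

(* The map induced by a balanced k-bilinear map f (see [tliftE]). *)
Definition tlift (P : lmodType k) (f : M -> N -> P) (t : tens) : P :=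
  \sum_(p <- repr t) f p.1 p.2.

End Tensor.

Arguments tpure {k R M N} ra la m n.
Arguments tlift {k R M N ra la P} f t.

Notation "M ⊗ N" := (tens (@scal _ M%type) (@scal _ N%type))
  (at level 40, left associativity) : type_scope.
Notation "m ⊗ n" := (tpure (@scal _ _) (@scal _ _) m n)
  (at level 40, left associativity) : ring_scope.

Section LinearProp.
Variables (k : comPzRingType) (M N : lmodType k) (f : M -> N).
Hypothesis hf : linear f.
Lemma lin0 : f 0 = 0. Proof. exact: (raddf0 (mklin hf)). Qed.
Lemma linD x y : f (x + y) = f x + f y.
Proof. exact: (raddfD (mklin hf)). Qed.
Lemma linZ c x : f (c *: x) = c *: f x. 
Proof. by rewrite -[c *: x]addr0 hf lin0 addr0. Qed.
Lemma linsum (I : Type) (s : seq I) (F : I -> M) :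
  f (\sum_(i <- s) F i) = \sum_(i <- s) f (F i).
Proof. exact: (raddf_sum (mklin hf)). Qed.
End LinearProp.

Section TensorTheory.
Variables (k : comPzRingType) (R : Type) (M N : lmodType k).
Variables (ra : R -> {linear M -> M}) (la : R -> {linear N -> N}).
Local Notation T := (tens ra la).
Local Notation pure := (tpure ra la).

Lemma tpure_lin_l n : linear (pure^~ n).
Proof.
move=> c m m'; apply: etrans (tens_addl_pi _ _ _ _ _) _.
by congr (_ + _); apply/esym/tens_pi_mulc.
Qed.

Lemma tpure_scal c m n : pure (c *: m) n = pure m (c *: n).
Proof. exact/tens_piP/tens_scal. Qed.

Lemma tpure_bal r m n : pure (ra r m) n = pure m (la r n).
Proof. exact/tens_piP/tens_bal. Qed.

Lemma tpure_lin_r m : linear (pure m).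
Proof.
move=> c n n'; transitivity (pure m (c *: n) + pure m n'); last first.
  rewrite -tpure_scal; congr (_ + _); apply: etrans (esym (tens_pi_mulc _ _ _ _)).
  by [].
by apply: etrans (esym (tens_pi_add _ _ _ _)); apply/tens_piP/tens_addr.
Qed.

Lemma tens_sum (t : T) : t = \sum_(p <- repr t) pure p.1 p.2.
Proof.
rewrite -{1}[t]reprK; elim: (repr t) => [|[m n] s IH]; first by rewrite big_nil.
by rewrite big_cons -IH; exact: tens_pi_cons.
Qed.

Lemma tens_ind (P : T -> Prop) :
  (forall m n, P (pure m n)) -> P 0 -> (forall x y, P x -> P y -> P (x + y)) ->
  forall t, P t.
Proof.
by move=> Pp P0 PD t; rewrite (tens_sum t); elim/big_ind: _.
Qed.

Section Lift.
Variable P : lmodType k.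
Implicit Types f g : M -> N -> P.

Lemma eq_tlift f g (t : T) : (forall m n, f m n = g m n) ->
  tlift f t = tlift g t.
Proof. by move=> fg; apply: eq_bigr => p _; exact: fg. Qed.

Lemma tlift_lin f g h c (t : T) : (forall m n, h m n = c *: f m n + g m n) ->
  tlift h t = c *: tlift f t + tlift g t.
Proof.
by move=> E; rewrite scaler_sumr -big_split; apply: eq_bigr => p _; exact: E.
Qed.

Lemma linear_tlift (Q : lmodType k) (L : P -> Q) f (t : T) : linear L ->
  L (tlift f t) = tlift (fun m n => L (f m n)) t.
Proof. by move=> hL; exact: linsum. Qed.

Definition balanced f :=
  [/\ forall n, linear (f^~ n), forall m, linear (f m) &
      forall r m n, f (ra r m) n = f m (la r n)].

Lemma tlift_rel f s t : balanced f -> tens_rel ra la s t ->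
  \sum_(p <- s) f p.1 p.2 = \sum_(p <- t) f p.1 p.2.
Proof.
case=> fl fr fb; elim=> {s t}.
- by [].
- by [].
- by move=> s t u _ -> _ ->.
- by move=> s s' t t' _ Es _ Et; rewrite !big_cat /= Es Et.
- by move=> s t; rewrite !big_cat /= addrC.
- by move=> n; rewrite big_seq1 big_nil; exact: (lin0 (fl n)).
- move=> m m' n; rewrite big_seq1 !big_cons big_nil addr0.
  exact: (linD (fl n)).
- move=> m n n'; rewrite big_seq1 !big_cons big_nil addr0.
  exact: (linD (fr m)).
- move=> c m n; rewrite !big_seq1 /=; apply: etrans (esym (linZ (fr m) _ _)).
  exact: (linZ (fl n)).
- by move=> r m n; rewrite !big_seq1 fb.
Qed.

Lemma tlift_pi f s : balanced f ->
  tlift f (\pi_T s) = \sum_(p <- s) f p.1 p.2.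
Proof. by move=> hf; apply: tlift_rel hf _; exact: tens_reprK. Qed.

Lemma tliftE f m n : balanced f -> tlift f (pure m n) = f m n.
Proof. by move=> hf; rewrite tlift_pi// big_seq1. Qed.

Lemma tlift_linear f : balanced f -> linear (tlift f : T -> P).
Proof.
move=> hf c; elim/quotW=> s; elim/quotW=> t.
have -> : c *: \pi_T s + \pi_T t
    = \pi_T ([seq (c *: p.1, p.2) | p <- s] ++ t).
  by apply: etrans (tens_pi_add _ _ _ _); congr (_ + _); exact: tens_pi_mulc.
rewrite !tlift_pi// big_cat big_map scaler_sumr; congr (_ + _).
case: hf => fl _ _; apply: eq_bigr => p _ /=.
exact: (linZ (fl p.2)).
Qed.

Lemma tens_ext (L L' : T -> P) : linear L -> linear L' ->
  (forall m n, L (pure m n) = L' (pure m n)) -> L =1 L'.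
Proof.
move=> hL hL' E t; rewrite (tens_sum t).
rewrite (linsum hL) (linsum hL').
by apply: eq_bigr => p _; exact: E.
Qed.

End Lift.

Lemma tlift_pure (t : T) : tlift pure t = t.
Proof. by rewrite [RHS]tens_sum. Qed.
End TensorTheory.

Lemma exchange_tlift (k : comPzRingType) (R R' : Type) (M N M' N' P : lmodType k)
    (ra : R -> {linear M -> M}) (la : R -> {linear N -> N})
    (ra' : R' -> {linear M' -> M'}) (la' : R' -> {linear N' -> N'})
    (f : M -> N -> M' -> N' -> P) (t : tens ra la) (t' : tens ra' la') :
  tlift (fun m n => tlift (f m n) t') t =
  tlift (fun m' n' => tlift (fun m n => f m n m' n') t) t'.
Proof. exact: exchange_big. Qed.

Definition kmul (k : comPzRingType) (A : kalg k) (a b : A) : A := a * b.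

Section TensorMaps.
Variable k : comPzRingType.
Implicit Types M N P : lmodType k.

Definition tmap M N M' N' (f : M -> M') (g : N -> N') (t : M ⊗ N) : M' ⊗ N' :=
  tlift (fun m n => f m ⊗ g n) t.

(* Maps (m ⊗ n, m' ⊗ n') to mu m m' ⊗ nu n n'; with x = rho(m), y = rho(n) this
   is Sweedler's m_[0] n_[0] ⊗ m_[1] n_[1]. *)
Definition tmul M N M' N' M'' N'' (mu : M -> M' -> M'') (nu : N -> N' -> N'')
    (t : M ⊗ N) (t' : M' ⊗ N') : M'' ⊗ N'' :=
  tlift (fun m n => tlift (fun m' n' => mu m m' ⊗ nu n n') t') t.

Definition tassoc M N P (t : (M ⊗ N) ⊗ P) : M ⊗ (N ⊗ P) :=
  tlift (fun u p => tlift (fun m n => m ⊗ (n ⊗ p)) u) t.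
End TensorMaps.

Definition projective (k : comPzRingType) (P : lmodType k) : Prop :=
  forall (M N : lmodType k) (g : {linear M -> N}) (f : {linear P -> N}),
    (forall y, exists x, g x = y) ->
    exists h : {linear P -> M}, forall x, g (h x) = f x.

Record hopfAlg (k : comPzRingType) := HopfAlg {
  hopf_alg :> kalg k;
  comul : {linear hopf_alg -> (hopf_alg ⊗ hopf_alg)%type};
  counit : {scalar hopf_alg};
  antip : {linear hopf_alg -> hopf_alg};
  antipV : hopf_alg -> hopf_alg;
  comulA : forall h : hopf_alg, tassoc (tmap comul idfun (comul h)) =
                     tmap idfun comul (comul h);
  counit_l : forall h : hopf_alg, tlift (fun h1 h2 : hopf_alg => counit h1 *: h2) (comul h) = h;
  counit_r : forall h : hopf_alg, tlift (fun h1 h2 : hopf_alg => counit h2 *: h1) (comul h) = h;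
  comul1 : comul 1 = (1 : hopf_alg) ⊗ (1 : hopf_alg);
  comulM : forall g h : hopf_alg, comul (g * h) =
    tmul (@kmul k hopf_alg) (@kmul k hopf_alg) (comul g) (comul h);
  counit1 : counit 1 = 1;
  counitM : forall g h : hopf_alg, counit (g * h) = counit g * counit h;
  antip_l : forall h : hopf_alg, tlift (fun h1 h2 : hopf_alg => antip h1 * h2) (comul h) =
                      counit h *: (1 : hopf_alg);
  antip_r : forall h : hopf_alg, tlift (fun h1 h2 : hopf_alg => h1 * antip h2) (comul h) =
                      counit h *: (1 : hopf_alg);
  antipK : cancel antip antipV;
  antipVK : cancel antipV antip
}.
Arguments antipV {k} _ _.

Section Comodules.
Variables (k : comPzRingType) (H : hopfAlg k).

Definition is_comodule (V : lmodType k) (rho : V -> V ⊗ H) : Prop :=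
  (forall v, tassoc (tmap rho idfun (rho v)) = tmap idfun (comul H) (rho v)) /\
  (forall v, tlift (fun v0 v1 => counit H v1 *: v0) (rho v) = v).

Definition colinear (V W : lmodType k) (rhoV : V -> V ⊗ H) (rhoW : W -> W ⊗ H)
    (f : V -> W) : Prop :=
  linear f /\ forall v, rhoW (f v) = tmap f idfun (rhoV v).

Record comodAlg := ComodAlg {
  comod_alg :> kalg k;
  acoact : {linear comod_alg -> (comod_alg ⊗ H)%type};
  acoact_comodule : is_comodule acoact;
  acoact1 : acoact 1 = (1 : comod_alg) ⊗ (1 : H);
  acoactM : forall a b : comod_alg, acoact (a * b) =
    tmul (@kmul k comod_alg) (@kmul k H) (acoact a) (acoact b)
}.

Definition coinv (A : comodAlg) : Type := {a : A | acoact A a = a ⊗ (1 : H)}.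

Definition galois_tens (A : comodAlg) :=
  tens (fun c : coinv A => rmul (sval c)) (fun c : coinv A => lmul (sval c)).

Definition can (A : comodAlg) : galois_tens A -> A ⊗ H :=
  tlift (fun a b => tmap (@kmul k A a) idfun (acoact A b)).

Definition is_galois (A : comodAlg) : Prop := bijective (@can A).

Record relHopfMod (A : comodAlg) := RelHopfMod {
  rhm_mod :> lmodType k;
  act : A -> {linear rhm_mod -> rhm_mod};
  coact : {linear rhm_mod -> (rhm_mod ⊗ H)%type};
  act_linear : forall v, linear (act^~ v);
  act1 : forall v, act 1 v = v;
  actM : forall a b v, act (a * b) v = act a (act b v);
  coact_comodule : is_comodule coact;
  coact_act : forall a v,
    coact (act a v) = tmul (fun a v => act a v) (@kmul k H) (acoact A a) (coact v)
}.

Record bimod (A B : comodAlg) := Bimod {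
  bm_rhm :> relHopfMod A;
  ract : B -> {linear bm_rhm -> bm_rhm};
  ract_linear : forall m, linear (ract^~ m);
  ract1 : forall m, ract 1 m = m;
  ractM : forall b c m, ract (b * c) m = ract c (ract b m);
  act_ract : forall a b m, act bm_rhm a (ract b m) = ract b (act bm_rhm a m);
  coact_ract : forall b m,
    coact bm_rhm (ract b m) = tmul (fun m b => ract b m) (@kmul k H) (coact bm_rhm m) (acoact B b)
}.
End Comodules.

Section LinearClosure.
Variable k : comPzRingType.
Implicit Types M N P Q : lmodType k.

Lemma lin_id M : linear (fun x : M => x). Proof. by []. Qed.
Lemma lin_app M N P (f : {linear N -> P}) (g : M -> N) :
  linear g -> linear (fun x => f (g x)).
Proof. by move=> hg c x y; rewrite hg linearP. Qed.
Lemma lin_comp M N P (f : N -> P) (g : M -> N) :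
  linear f -> linear g -> linear (fun x => f (g x)).
Proof. by move=> hf hg c x y; rewrite hg hf. Qed.
Lemma lin_pure_l M N P R (ra : R -> {linear N -> N}) (la : R -> {linear P -> P})
  (g : M -> N) p : linear g -> linear (fun x => tpure ra la (g x) p).
Proof. by move=> hg c x y; rewrite hg tpure_lin_l. Qed.
Lemma lin_pure_r M N P R (ra : R -> {linear N -> N}) (la : R -> {linear P -> P})
  (g : M -> P) n : linear g -> linear (fun x => tpure ra la n (g x)).
Proof. by move=> hg c x y; rewrite hg tpure_lin_r. Qed.
Lemma lin_mul_l M (A : kalg k) (g : M -> A) (a : A) :
  linear g -> linear (fun x => g x * a : A).
Proof. by move=> hg c x y; rewrite hg mulrDl kalg_scalerAl. Qed.
Lemma lin_mul_r M (A : kalg k) (g : M -> A) (a : A) :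
  linear g -> linear (fun x => a * g x : A).
Proof. by move=> hg c x y; rewrite hg mulrDr kalg_scalerAr. Qed.
Lemma lin_scal M N (g : M -> N) (c : k) :
  linear g -> linear (fun x => c *: g x).
Proof. by move=> hg a x y; rewrite hg scalerDr !scalerA mulrC. Qed.
Lemma lin_scalar M N (g : {scalar M}) (n : N) :
  linear (fun x => g x *: n).
Proof. by move=> a x y; rewrite linearP scalerDl scalerA. Qed.
Lemma lin_tlift_f M N P Q R (ra : R -> {linear N -> N})
    (la : R -> {linear P -> P}) (F : M -> N -> P -> Q) (t : tens ra la) :
  (forall n p, linear (fun x => F x n p)) -> linear (fun x => tlift (F x) t).
Proof. by move=> hF c x y; apply: tlift_lin => n p; exact: hF. Qed.
Lemma lin_tlift M N P Q R (ra : R -> {linear N -> N})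
    (la : R -> {linear P -> P}) (f : N -> P -> Q) (g : M -> tens ra la) :
  balanced ra la f -> linear g -> linear (fun x => tlift f (g x)).
Proof. by move=> hf hg c x y; rewrite hg tlift_linear. Qed.

Lemma kbalanced M N P (f : M -> N -> P) :
  (forall n, linear (f^~ n)) -> (forall m, linear (f m)) ->
  balanced (@scal _ M) (@scal _ N) f.
Proof.
move=> fl fr; split=> // c m n /=.
by rewrite [LHS](linZ (fl n)) [RHS](linZ (fr m)).
Qed.

Variables (H : hopfAlg k).
Lemma lin_act_l (A : comodAlg H) (V : relHopfMod A) M (g : M -> A) v :
  linear g -> linear (fun x => act V (g x) v).
Proof. by move=> hg c x y; rewrite hg (act_linear v). Qed.
Lemma lin_ract_l (A B : comodAlg H) (V : bimod A B) M (g : M -> B) v :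
  linear g -> linear (fun x => ract V (g x) v).
Proof. by move=> hg c x y; rewrite hg (ract_linear v). Qed.

Lemma antipV_linear : linear (antipV H).
Proof.
move=> c x y; apply: (can_inj (@antipK _ H)).
by rewrite linearP !antipVK.
Qed.
Definition antipVl : {linear H -> H} := mklin antipV_linear.
End LinearClosure.

Ltac lin := cbv beta delta [tmap tmul tassoc kmul idfun];
  first
  [ solve [exact: lin_id]
  | solve [exact: linearP]
  | assumption
  | solve [apply: antipV_linear]
  | solve [apply: lin_mul_l; lin]
  | solve [apply: lin_mul_r; lin]
  | solve [apply: lin_act_l; lin]
  | solve [apply: lin_ract_l; lin]
  | solve [apply: lin_pure_l; lin]
  | solve [apply: lin_pure_r; lin]
  | solve [apply: lin_tlift_f; intros ? ?; lin]
  | solve [apply: lin_tlift; [bal | lin]]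
  | solve [apply: (lin_comp (@antipV_linear _ _)); lin]
  | solve [apply: lin_app; lin]
  | solve [exact: lin_scalar]
  | solve [apply: lin_scal; lin] ]
with bal := apply: kbalanced; intros ?; lin.

Section TliftMaps.
Variable k : comPzRingType.
Implicit Types M N P Q : lmodType k.

Lemma tlift_tmap M N M' N' P (G : M' -> N' -> P) (f : M -> M') (g : N -> N')
    (t : M ⊗ N) :
  (forall n, linear (G^~ n)) -> (forall m, linear (G m)) ->
  tlift G (tmap f g t) = tlift (fun m n => G (f m) (g n)) t.
Proof.
move=> G1 G2; have hG := kbalanced G1 G2.
rewrite (linear_tlift _ _ (tlift_linear hG)).
by apply: eq_tlift => m n; rewrite tliftE.
Qed.

Lemma tlift_tmul M N M' N' M'' N'' P (G : M'' -> N'' -> P)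
    (mu : M -> M' -> M'') (nu : N -> N' -> N'') (t : M ⊗ N) (t' : M' ⊗ N') :
  (forall n, linear (G^~ n)) -> (forall m, linear (G m)) ->
  tlift G (tmul mu nu t t') =
  tlift (fun m n => tlift (fun m' n' => G (mu m m') (nu n n')) t') t.
Proof.
move=> G1 G2; have hG := kbalanced G1 G2.
rewrite (linear_tlift _ _ (tlift_linear hG)).
apply: eq_tlift => m n; rewrite (linear_tlift _ _ (tlift_linear hG)).
by apply: eq_tlift => m' n'; rewrite tliftE.
Qed.

Lemma tlift_tassoc M N P Q (G : M -> N ⊗ P -> Q) (t : (M ⊗ N) ⊗ P) :
  (forall n, linear (G^~ n)) -> (forall m, linear (G m)) ->
  tlift G (tassoc t) = tlift (fun u p => tlift (fun m n => G m (n ⊗ p)) u) t.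
Proof.
move=> G1 G2; have hG := kbalanced G1 G2.
rewrite (linear_tlift _ _ (tlift_linear hG)).
apply: eq_tlift => u p; rewrite (linear_tlift _ _ (tlift_linear hG)).
by apply: eq_tlift => m n; rewrite tliftE.
Qed.
End TliftMaps.

Section Sweedler.
Variables (k : comPzRingType) (H : hopfAlg k).
Local Notation S := (antip H).
Local Notation S' := (antipV H).
Local Notation D := (comul H).
Local Notation e := (counit H).

Section Comod.
Variables (V : lmodType k) (rho : {linear V -> (V ⊗ H)%type}).
Hypothesis hrho : is_comodule rho.

Lemma sw_assoc (P : lmodType k) (F : V -> H -> H -> P) v :
  (forall g h, linear (fun x => F x g h)) ->
  (forall x h, linear (fun g => F x g h)) ->
  (forall x g, linear (fun h => F x g h)) ->
  tlift (fun v h => tlift (fun v' h' => F v' h' h) (rho v)) (rho v) =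
  tlift (fun v h => tlift (fun h1 h2 => F v h1 h2) (D h)) (rho v).
Proof.
move=> F1 F2 F3.
have hF x : balanced (@scal _ H) (@scal _ H) (F x) by apply: kbalanced.
have G1 (t : H ⊗ H) : linear (fun x => tlift (F x) t).
  by apply: lin_tlift_f => g h; exact: F1.
have G2 x := tlift_linear (hF x).
have := congr1 (tlift (fun x t => tlift (F x) t)) (hrho.1 v).
rewrite tlift_tassoc // tlift_tmap //; last first.
- by move=> u; apply: lin_tlift_f => x g; apply: lin_comp (G2 x) _; lin.
- move=> h; apply: lin_tlift; last by lin.
  apply: kbalanced => [g|x]; last by apply: lin_comp (G2 x) _; lin.
  exact: G1.
rewrite tlift_tmap // => E.
etransitivity; last exact: E.
by apply: eq_tlift => x h; apply: eq_tlift => y g; rewrite tliftE.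
Qed.

Lemma sw_counit (P : lmodType k) (F : V -> P) v : linear F ->
  tlift (fun v h => e h *: F v) (rho v) = F v.
Proof.
move=> hF; rewrite -[in RHS](hrho.2 v) (linear_tlift _ _ hF).
by apply: eq_tlift => m n; rewrite (linZ hF).
Qed.
End Comod.

Lemma comul_comodule : is_comodule D.
Proof. by split=> h; [exact: comulA | exact: counit_r]. Qed.

Lemma sw_comul (P : lmodType k) (F : H -> H -> H -> P) h :
  (forall g h, linear (fun x => F x g h)) ->
  (forall x h, linear (fun g => F x g h)) ->
  (forall x g, linear (fun h => F x g h)) ->
  tlift (fun v h => tlift (fun v' h' => F v' h' h) (D v)) (D h) =
  tlift (fun v h => tlift (fun h1 h2 => F v h1 h2) (D h)) (D h).
Proof. exact: sw_assoc comul_comodule _ _ _. Qed.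

Lemma sw_counit_r (P : lmodType k) (F : H -> P) h : linear F ->
  tlift (fun g h => e h *: F g) (D h) = F h.
Proof. exact: (sw_counit comul_comodule). Qed.

Lemma sw_counit_l (P : lmodType k) (F : H -> P) h : linear F ->
  tlift (fun g h => e g *: F h) (D h) = F h.
Proof.
move=> hF; rewrite -[in RHS](counit_l h) (linear_tlift _ _ hF).
by apply: eq_tlift => m n; rewrite (linZ hF).
Qed.

Lemma sw_antip_l (P : lmodType k) (F : H -> P) h : linear F ->
  tlift (fun g h : H => F (S g * h)) (D h) = e h *: F 1.
Proof.
by move=> hF; rewrite -(linear_tlift _ _ hF) antip_l (linZ hF).
Qed.
Lemma sw_antip_r (P : lmodType k) (F : H -> P) h : linear F ->
  tlift (fun g h : H => F (g * S h)) (D h) = e h *: F 1.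
Proof.
by move=> hF; rewrite -(linear_tlift _ _ hF) antip_r (linZ hF).
Qed.

Lemma antip1 : S 1 = 1.
Proof.
have := antip_l (1 : H); rewrite comul1 tliftE; last by bal.
by rewrite mulr1 counit1 scale1r.
Qed.

Lemma sw_comulM (P : lmodType k) (F : H -> H -> P) g h :
  (forall y, linear (fun x : H => F x y)) -> (forall x, linear (F x)) ->
  tlift F (D (g * h)) =
  tlift (fun g1 g2 : H => tlift (fun h1 h2 : H => F (g1 * h1) (g2 * h2)) (D h)) (D g).
Proof.
move=> F1 F2; have hF := kbalanced F1 F2.
rewrite comulM /tmul (linear_tlift _ _ (tlift_linear hF)).
apply: eq_tlift => g1 g2; rewrite (linear_tlift _ _ (tlift_linear hF)).
by apply: eq_tlift => h1 h2; rewrite tliftE.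
Qed.

(* S(gh) is expanded to S(g1 h1) g2 h2 S(h3) S(g3) *)
Lemma antipM g h : S (g * h) = S h * S g.
Proof.
transitivity (tlift (fun g1 g' : H => tlift (fun h1 h' : H =>
   tlift (fun g2 g3 : H => tlift (fun h2 h3 : H =>
     S (g1 * h1) * (g2 * h2 * (S h3 * S g3))) (D h')) (D g')) (D h)) (D g)).
  rewrite -[in LHS](sw_counit_r (F := fun g : H => S (g * h))); last by lin.
  apply: eq_tlift => g1 g'.
  rewrite -(sw_counit_r (F := fun h : H => e g' *: S (g1 * h))); last by lin.
  apply: eq_tlift => h1 h'; symmetry.
  transitivity (tlift (fun g2 g3 : H => e h' *: (S (g1 * h1) * (g2 * S g3))) (D g')).
    apply: eq_tlift => g2 g3.
    transitivity (tlift (fun h2 h3 : H => S (g1 * h1) * (g2 * (h2 * S h3 * S g3)))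
      (D h')); first by apply: eq_tlift => h2 h3; rewrite !mulrA.
    rewrite (sw_antip_r (F := fun x : H => S (g1 * h1) * (g2 * (x * S g3)))).
      by rewrite mul1r.
    by lin.
  rewrite (sw_antip_r (F := fun x : H => e h' *: (S (g1 * h1) * x))); last by lin.
  by rewrite mulr1 !scalerA mulrC.
transitivity (tlift (fun g1 g3 : H => tlift (fun h1 h3 : H =>
   e (g1 * h1) *: (S h3 * S g3)) (D h)) (D g)); last first.
  transitivity (tlift (fun g1 g3 : H => e g1 *: (S h * S g3)) (D g)).
    apply: eq_tlift => g1 g3.
    transitivity (tlift (fun h1 h3 : H => e h1 *: (e g1 *: (S h3 * S g3))) (D h)).
      by apply: eq_tlift => h1 h3; rewrite counitM scalerA mulrC.
    by rewrite (sw_counit_l (F := fun x : H => e g1 *: (S x * S g3))) //; lin.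
  by rewrite (sw_counit_l (F := fun x : H => S h * S x)) //; lin.
transitivity (tlift (fun g' g3 : H => tlift (fun h' h3 : H =>
   tlift (fun g1 g2 : H => tlift (fun h1 h2 : H =>
     S (g1 * h1) * (g2 * h2) * (S h3 * S g3)) (D h')) (D g')) (D h)) (D g)).
  transitivity (tlift (fun g1 g' : H => tlift (fun g2 g3 : H =>
    tlift (fun h1 h' : H => tlift (fun h2 h3 : H =>
     S (g1 * h1) * (g2 * h2 * (S h3 * S g3))) (D h')) (D h)) (D g')) (D g)).
    by apply: eq_tlift => g1 g'; rewrite exchange_tlift.
  rewrite -(sw_comul (F := fun g1 g2 g3 : H => tlift (fun h1 h' : H => tlift
    (fun h2 h3 : H => S (g1 * h1) * (g2 * h2 * (S h3 * S g3))) (D h')) (D h)));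
    try by [move=> ? ?; lin].
  apply: eq_tlift => g' g3.
  rewrite [RHS]exchange_tlift; apply: eq_tlift => g1 g2.
  rewrite -(sw_comul (F := fun h1 h2 h3 : H =>
    S (g1 * h1) * (g2 * h2 * (S h3 * S g3)))); try by [move=> ? ?; lin].
  by apply: eq_tlift => h' h3; apply: eq_tlift => h1 h2; rewrite !mulrA.
apply: eq_tlift => g' g3; apply: eq_tlift => h' h3.
rewrite -(sw_comulM (F := fun x y : H => S x * y * (S h3 * S g3)));
  try by [move=> ?; lin].
by rewrite (sw_antip_l (F := fun x : H => x * (S h3 * S g3))) ?mul1r //; lin.
Qed.

Lemma antipV1 : S' 1 = 1.
Proof. by rewrite -[in LHS]antip1 antipK. Qed.
Lemma antipVM g h : S' (g * h) = S' h * S' g.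
Proof. by apply: (can_inj (@antipK _ H)); rewrite antipM !antipVK. Qed.

Lemma sw_antipV_l (P : lmodType k) (F : H -> P) h : linear F ->
  tlift (fun g h : H => F (S' h * g)) (D h) = e h *: F 1.
Proof.
move=> hF; rewrite -(linear_tlift _ _ hF) -(linZ hF); congr F.
apply: (can_inj (@antipK _ H)).
rewrite (linear_tlift (L := S)); last exact: linearP.
rewrite linearZ /= antip1 -antip_l.
by apply: eq_tlift => x y; rewrite antipM antipVK.
Qed.
Lemma sw_antipV_r (P : lmodType k) (F : H -> P) h : linear F ->
  tlift (fun g h : H => F (h * S' g)) (D h) = e h *: F 1.
Proof.
move=> hF; rewrite -(linear_tlift _ _ hF) -(linZ hF); congr F.
apply: (can_inj (@antipK _ H)).
rewrite (linear_tlift (L := S)); last exact: linearP.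
rewrite linearZ /= antip1 -antip_r.
by apply: eq_tlift => x y; rewrite antipM antipVK.
Qed.
End Sweedler.

Record category := Category {
  obj :> Type;
  hom : obj -> obj -> Type;
  idm : forall X, hom X X;
  comp : forall X Y Z, hom Y Z -> hom X Y -> hom X Z;
  comp_idl : forall X Y (f : hom X Y), comp (idm Y) f = f;
  comp_idr : forall X Y (f : hom X Y), comp f (idm X) = f;
  comp_assoc : forall W X Y Z (f : hom Y Z) (g : hom X Y) (h : hom W X),
    comp f (comp g h) = comp (comp f g) h
}.
Arguments idm {_} X.

Record functor (C D : category) := Functor {
  fobj :> C -> D;
  fmap : forall X Y, hom X Y -> hom (fobj X) (fobj Y);
  fmap_id : forall X, fmap (idm X) = idm (fobj X);
  fmap_comp : forall X Y Z (f : hom Y Z) (g : hom X Y),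
    fmap (comp f g) = comp (fmap f) (fmap g)
}.
Arguments fmap {C D} F {X Y} f : rename.

Definition functor_id (C : category) : functor C C :=
  @Functor C C (fun X => X) (fun X Y f => f) (fun X => erefl)
    (fun X Y Z f g => erefl).

Section FunctorComp.
Variables (C D E : category) (G : functor D E) (F : functor C D).
Let cmap X Y (f : hom X Y) : hom (G (F X)) (G (F Y)) := fmap G (fmap F f).
Let cmap_id X : cmap (idm X) = idm (G (F X)).
Proof. by rewrite /cmap !fmap_id. Qed.
Let cmap_comp X Y Z (f : hom Y Z) (g : hom X Y) :
  cmap (comp f g) = comp (cmap f) (cmap g).
Proof. by rewrite /cmap !fmap_comp. Qed.
Definition functor_comp : functor C E := Functor cmap_id cmap_comp.
End FunctorComp.

Definition functor_iso (C D : category) (F G : functor C D) : Prop :=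
  exists (phi : forall X, hom (F X) (G X)) (psi : forall X, hom (G X) (F X)),
    [/\ forall X Y (f : hom X Y), comp (phi Y) (fmap F f) =
                                  comp (fmap G f) (phi X),
        forall X, comp (phi X) (psi X) = idm (G X) &
        forall X, comp (psi X) (phi X) = idm (F X)].

Definition inverse_equivalences (C D : category)
    (T : functor C D) (U : functor D C) : Prop :=
  functor_iso (functor_comp U T) (functor_id C) /\
  functor_iso (functor_comp T U) (functor_id D).

Section Ahom.
Variables (k : comPzRingType) (H : hopfAlg k) (A : comodAlg H).

Section Def.
Variables (V W : relHopfMod A).

Definition is_ahom (f : V -> W) : Prop :=
  (forall u v, f (u + v) = f u + f v) /\
  (forall a v, f (act V a v) = act W a (f v)).

(* restriction of scalars along k -> A *)
Lemma act_scalar (U : relHopfMod A) (c : k) (v : U) :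
  act U (c *: (1 : A)) v = c *: v.
Proof. by rewrite (linZ (act_linear v)) act1. Qed.

Lemma is_ahom_linear (f : V -> W) : is_ahom f -> linear f.
Proof. by case=> fD fA c x y; rewrite fD -act_scalar fA act_scalar. Qed.

Definition ahom_pred : {pred V -> W} := [pred f | `[< is_ahom f >]].

Fact ahom_pred_closed : submod_closed ahom_pred.
Proof.
split=> [|c f g].
  by apply/asboolP; split=> [u v|a v]; rewrite ?addr0 ?linear0.
move=> /asboolP[fD fA] /asboolP[gD gA]; apply/asboolP.
split=> [u v|a v]; rewrite !(addrfctE, scalrfctE) /=.
  by rewrite fD gD scalerDr addrACA.
by rewrite fA gA linearD linearZ.
Qed.
HB.instance Definition _ :=
  GRing.isSubmodClosed.Build k (V -> W) ahom_pred ahom_pred_closed.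

Record ahom := AHom { ahom_fun :> V -> W; _ : ahom_fun \in ahom_pred }.
HB.instance Definition _ := [isSub for ahom_fun].
HB.instance Definition _ := [Choice of ahom by <:].
HB.instance Definition _ := [SubChoice_isSubLmodule of ahom by <:].

Lemma ahomP (f : ahom) : is_ahom f.
Proof. by case: f => f /= /asboolP. Qed.
HB.instance Definition _ (f : ahom) := GRing.isLinear.Build k V W *:%R f
  (is_ahom_linear (ahomP f)).

(* f_[0](m) ⊗ f_[1] = f(m_[0])_[0] ⊗ S^-1(m_[1]) f(m_[0])_[1], where
   x = f_[0] ⊗ f_[1] *)
Definition HOM_coact_eq (f : ahom) (x : ahom ⊗ H) : Prop :=
  forall m, tmap (fun g : ahom => g m) idfun x =
    tlift (fun m0 m1 => tmap idfun (kmul (antipV H m1)) (coact W (f m0)))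
      (coact V m).

Definition HOM_pred : {pred ahom} := [pred f | `[< exists x, HOM_coact_eq f x >]].
Record HOM := Hom { HOM_ahom :> ahom; _ : HOM_ahom \in HOM_pred }.
End Def.
End Ahom.
Arguments ahom_pred {k H A} V W.
Arguments HOM_pred {k H A} V W.

Section HOM.
Variables (k : comPzRingType) (H : hopfAlg k) (A : comodAlg H).
Implicit Types U V W : relHopfMod A.
Local Notation S' := (antipV H).

Lemma ev_linear V W (m : V) : linear (fun f : ahom V W => f m).
Proof.
move=> c f g; have := linearP (\val : ahom V W -> V -> W) c f g.
exact: (congr1 (@^~ m)).
Qed.

Lemma ahom_eqP V W (f g : ahom V W) : (forall v, f v = g v) -> f = g.
Proof. by move=> fg; apply/val_inj/funext. Qed.

Fact HOM_pred_closed V W : submod_closed (HOM_pred V W).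
Proof.
have lin_coact m : linear (fun x : (ahom V W ⊗ H)%type =>
    tmap (fun g : ahom V W => g m) idfun x).
  apply: lin_tlift; last by lin.
  by apply: kbalanced => ?; [apply: lin_pure_l; exact: ev_linear | lin].
split=> [|c f g].
  apply/asboolP; exists 0 => m; rewrite (lin0 (lin_coact m)).
  rewrite [RHS]big1 // => p _; rewrite [X in coact W X](_ : _ = 0) //.
  by rewrite linear0; apply: (@lin0 _ _ _ (tmap idfun (kmul (S' p.2)))); lin.
move=> /asboolP[x hx] /asboolP[y hy]; apply/asboolP.
exists (c *: x + y) => m; rewrite (lin_coact m) hx hy.
symmetry; apply: tlift_lin => m0 m1.
rewrite [X in coact W X](ev_linear m0) linearP.
have : linear (tmap (N := H) (N' := H) (@idfun W) (kmul (S' m1))) by lin.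
by apply.
Qed.
HB.instance Definition _ V W :=
  GRing.isSubmodClosed.Build k (ahom V W) (HOM_pred V W)
    (@HOM_pred_closed V W).
HB.instance Definition _ V W := [isSub for @HOM_ahom k H A V W].
HB.instance Definition _ V W := [Choice of HOM V W by <:].
HB.instance Definition _ V W := [SubChoice_isSubLmodule of HOM V W by <:].

Lemma HOMP V W (f : HOM V W) : exists x, HOM_coact_eq f x.
Proof. by case: f => f /= /asboolP. Qed.

(* The element f_[0] ⊗ f_[1] lies in HOM(V, W) ⊗ H and is unique when H is
   projective; the default value 0 is then never used. *)
Definition HOM_coact V W (f : HOM V W) : HOM V W ⊗ H :=
  xget 0 [set x | HOM_coact_eq f (tmap (@HOM_ahom _ _ _ V W) idfun x)]%classic.

Fact aid_subproof V : (fun v => v) \in ahom_pred V V.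
Proof. exact/asboolP. Qed.
Definition aid V : ahom V V := AHom (aid_subproof V).

Fact acomp_subproof U V W (g : ahom V W) (f : ahom U V) :
  (fun u => g (f u)) \in ahom_pred U W.
Proof.
apply/asboolP; have [gD gA] := ahomP g; have [fD fA] := ahomP f.
by split=> [u v|a v]; rewrite ?fD ?gD ?fA ?gA.
Qed.
Definition acomp U V W (g : ahom V W) (f : ahom U V) : ahom U W :=
  AHom (acomp_subproof g f).

Fact HOM_id_subproof V : aid V \in HOM_pred V V.
Proof.
apply/asboolP; exists (aid V ⊗ (1 : H)) => m.
rewrite /tmap tliftE; last first.
  by apply: kbalanced => ?; [apply: lin_pure_l; exact: ev_linear | lin].
rewrite /= (sw_assoc (coact_comodule V)
  (F := fun x g h => x ⊗ (S' h * g : H))); try by [move=> ? ?; lin].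
transitivity (tlift (fun v h => counit H h *: (v ⊗ (1 : H))) (coact V m)).
  by rewrite (sw_counit (coact_comodule V) (F := fun v => v ⊗ (1 : H))) //; lin.
apply: eq_tlift => v h.
by rewrite (sw_antipV_l (F := fun h : H => v ⊗ h)) //; lin.
Qed.

Fact HOM_comp_subproof U V W (g : HOM V W) (f : HOM U V) :
  acomp g f \in HOM_pred U W.
Proof.
apply/asboolP; have [x hx] := HOMP f; have [y hy] := HOMP g.
exists (tlift (fun (fi : ahom U V) (hi : H) =>
   tlift (fun (gj : ahom V W) (hj : H) => acomp gj fi ⊗ (hi * hj : H)) y) x).
move=> m.
pose G (v : V) (h : H) := tlift (fun (gj : ahom V W) (hj : H) =>
  gj v ⊗ (h * hj : H)) y.
have G1 h : linear (G^~ h).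
  by apply: lin_tlift_f => gj hj; apply: lin_pure_l; exact: linearP.
have G2 v : linear (G v) by rewrite /G; lin.
have evb : balanced (@scal k (ahom U W)) (@scal k H)
    (fun p h => p m ⊗ idfun h).
  by apply: kbalanced => ?; [apply: lin_pure_l; exact: ev_linear | lin].
transitivity (tlift G (tmap (fun p : ahom U V => p m) idfun x)).
  rewrite tlift_tmap // [LHS](linear_tlift _ _ (tlift_linear evb)).
  apply: eq_tlift => fi hi; rewrite (linear_tlift _ _ (tlift_linear evb)).
  by apply: eq_tlift => gj hj; rewrite tliftE.
rewrite hx (linear_tlift _ _ (tlift_linear (kbalanced G1 G2))).
apply: eq_tlift => m0 m1; rewrite tlift_tmap //.
have GE v h : G v h = tlift (fun v0 v1 => tlift (fun w0 w1 =>
    w0 ⊗ (h * (S' v1 * w1) : H)) (coact W (g v0))) (coact V v).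
  transitivity (tlift (fun w hj => w ⊗ (h * hj : H))
    (tmap (fun p : ahom V W => p v) idfun y)).
    by rewrite tlift_tmap // => ?; lin.
  rewrite hy (linear_tlift (L := tlift _)); last by lin.
  by apply: eq_tlift => v0 v1; rewrite tlift_tmap // => ?; lin.
under eq_tlift do rewrite GE.
rewrite (sw_assoc (coact_comodule V) (F := fun v a b =>
  tlift (fun w0 w1 => w0 ⊗ (kmul (S' m1) b * (S' a * w1) : H))
    (coact W (g v)))); try by [move=> ? ?; lin].
pose K v := tmap idfun (kmul (S' m1)) (coact W (g v)).
transitivity (tlift (fun v h => counit H h *: K v) (coact V (f m0))); last first.
  by rewrite (sw_counit (coact_comodule V) (F := K)) // /K; lin.
apply: eq_tlift => v h.
transitivity (tlift (fun a b : H => tlift (fun w0 w1 =>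
    w0 ⊗ (S' m1 * ((b * S' a) * w1) : H)) (coact W (g v))) (comul H h)).
  apply: eq_tlift => a b; apply: eq_tlift => w0 w1.
  by rewrite /kmul !mulrA.
rewrite (sw_antipV_r (F := fun x : H => tlift (fun w0 w1 =>
    w0 ⊗ (S' m1 * (x * w1) : H)) (coact W (g v)))); last by lin.
by congr (_ *: _); apply: eq_tlift => w0 w1; rewrite mul1r.
Qed.

Definition HOM_id V : HOM V V := Hom (HOM_id_subproof V).
Definition HOM_comp U V W (g : HOM V W) (f : HOM U V) : HOM U W :=
  Hom (HOM_comp_subproof g f).

Lemma HOM_eqP V W (f g : HOM V W) : (forall v, f v = g v) -> f = g.
Proof. by move=> fg; apply/val_inj/ahom_eqP. Qed.
End HOM.

Section HOMcat.
Variables (k : comPzRingType) (H : hopfAlg k) (A : comodAlg H).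

Let HOM_idl V W (f : HOM (A := A) V W) : HOM_comp (HOM_id W) f = f.
Proof. exact: HOM_eqP. Qed.
Let HOM_idr V W (f : HOM (A := A) V W) : HOM_comp f (HOM_id V) = f.
Proof. exact: HOM_eqP. Qed.
Let HOM_compA U V W X (f : HOM (A := A) W X) (g : HOM V W) (h : HOM U V) :
  HOM_comp f (HOM_comp g h) = HOM_comp (HOM_comp f g) h.
Proof. exact: HOM_eqP. Qed.

Definition HOMcat : category :=
  Category HOM_idl HOM_idr HOM_compA.
End HOMcat.

Definition colinear_functor (k : comPzRingType) (H : hopfAlg k)
    (A B : comodAlg H) (T : functor (HOMcat A) (HOMcat B)) : Prop :=
  forall V W : relHopfMod A,
    colinear (@HOM_coact _ _ _ V W) (@HOM_coact _ _ _ (T V) (T W))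
      (fun f : HOM V W => fmap T f : HOM (T V) (T W)).

Section BTens.
Variables (k : comPzRingType) (H : hopfAlg k) (A B : comodAlg H).
Variables (M : bimod A B) (V : relHopfMod B).

Definition btens := tens (ract M) (act V).
HB.instance Definition _ := GRing.Lmodule.on btens.
Local Notation pure := (tpure (ract M) (act V)).

Let act_fun (a : A) : btens -> btens := tlift (fun m v => pure (act M a m) v).
Let act_bal a : balanced (ract M) (act V) (fun m v => pure (act M a m) v).
Proof.
split=> [v|m|b m v]; [lin | lin |].
by rewrite act_ract tpure_bal.
Qed.
Let act_lin a : linear (act_fun a). Proof. exact: tlift_linear. Qed.
Definition btens_act (a : A) : {linear btens -> btens} := mklin (act_lin a).

Lemma btens_actE a m v : btens_act a (pure m v) = pure (act M a m) v.
Proof. exact: (tliftE _ _ (act_bal a)). Qed.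

Let coact_fun : btens -> btens ⊗ H :=
  tlift (fun m v => tmul (pure : M -> V -> btens) (@kmul k H)
    (coact M m) (coact V v)).
Let coact_bal : balanced (ract M) (act V)
  (fun m v => tmul (pure : M -> V -> btens) (@kmul k H)
    (coact M m) (coact V v)).
Proof.
split=> [v|m|b m v]; [lin | lin |].
rewrite coact_ract coact_act.
rewrite {1}/tmul tlift_tmul; try by move=> ?; lin.
apply: eq_tlift => m0 m1.
transitivity (tlift (fun (b0 : B) (b1 : H) => tlift (fun v0 v1 =>
   (pure m0 (act V b0 v0) : btens) ⊗ (m1 * (b1 * v1) : H)) (coact V v))
   (acoact B b)).
  apply: eq_tlift => b0 b1; apply: eq_tlift => v0 v1.
  by rewrite tpure_bal /kmul mulrA.
by rewrite tlift_tmul // => ?; lin.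
Qed.
Let coact_lin : linear coact_fun. Proof. exact: tlift_linear. Qed.
Definition btens_coact : {linear btens -> (btens ⊗ H)%type} := mklin coact_lin.

Lemma btens_coactE m v : btens_coact (pure m v) =
  tmul (pure : M -> V -> btens) (@kmul k H) (coact M m) (coact V v).
Proof. exact: (tliftE _ _ coact_bal). Qed.

Let act_linear t : linear (btens_act^~ t).
Proof. by apply: lin_tlift_f => m v; lin. Qed.

Let act1 t : btens_act 1 t = t.
Proof.
by rewrite -[RHS]tlift_pure; apply: eq_tlift => m v; rewrite act1.
Qed.

Let actM a b t : btens_act (a * b) t = btens_act a (btens_act b t).
Proof.
apply: (tens_ext (L := btens_act (a * b))
  (L' := fun t => btens_act a (btens_act b t))).
- exact: linearP.
- by lin.
- by move=> m v; rewrite !btens_actE actM.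
Qed.

Let coact_comodule : is_comodule btens_coact.
Proof.
split=> t.
  apply: (tens_ext (L := fun t => tassoc (tmap btens_coact idfun (btens_coact t)))
     (L' := fun t => tmap idfun (comul H) (btens_coact t))).
  - by lin.
  - by lin.
  move=> m v; rewrite btens_coactE.
  rewrite {1}/tassoc tlift_tmap; try by move=> ?; lin.
  rewrite tlift_tmul; try by move=> ?; lin.
  rewrite [RHS]tlift_tmul; try by move=> ?; lin.
  pose F m0 (g0 g1 : H) v0 (h0 h1 : H) : btens ⊗ (H ⊗ H) :=
    (pure m0 v0 : btens) ⊗ ((g0 * h0 : H) ⊗ (g1 * h1 : H)).
  transitivity (tlift (fun m0 g => tlift (fun m1 g0 => tlift (fun v0 h =>
     tlift (fun v1 h0 => F m1 g0 g v1 h0 h) (coact V v0)) (coact V v))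
     (coact M m0)) (coact M m)).
    apply: eq_tlift => m0 g; rewrite [RHS]exchange_tlift.
    apply: eq_tlift => v0 h; rewrite /= btens_coactE.
    by rewrite tlift_tmul // => ?; lin.
  rewrite (sw_assoc (coact_comodule M) (F := fun m1 g0 g => tlift
    (fun v0 h => tlift (fun v1 h0 => F m1 g0 g v1 h0 h) (coact V v0))
    (coact V v))); try by [rewrite /F => ? ?; lin].
  apply: eq_tlift => m0 g.
  transitivity (tlift (fun g0 g1 : H => tlift (fun v0 h =>
     tlift (fun h0 h1 : H => F m0 g0 g1 v0 h0 h1) (comul H h)) (coact V v))
     (comul H g)).
    apply: eq_tlift => g0 g1.
    by rewrite (sw_assoc (coact_comodule V) (F := F m0 g0 g1)) //
      /F => ? ?; lin.
  rewrite exchange_tlift; apply: eq_tlift => v0 h.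
  rewrite comulM [RHS](linear_tlift (L := fun x => _ ⊗ x)); last by lin.
  apply: eq_tlift => g0 g1.
  by rewrite [RHS](linear_tlift (L := fun x => _ ⊗ x)) //; lin.
apply: (tens_ext (L := fun t => tlift (fun v0 v1 => counit H v1 *: v0)
  (btens_coact t)) (L' := id)) => //.
  by lin.
move=> m v; rewrite btens_coactE tlift_tmul; try by move=> ?; lin.
transitivity (tlift (fun m0 g => counit H g *: (pure m0 v : btens)) (coact M m)).
  apply: eq_tlift => m0 g.
  transitivity (tlift (fun v0 h => counit H h *:
     (counit H g *: (pure m0 v0 : btens))) (coact V v)).
    by apply: eq_tlift => v0 h; rewrite counitM scalerA mulrC.
  by rewrite (sw_counit (coact_comodule V)
    (F := fun v0 => counit H g *: (pure m0 v0 : btens))) //; lin.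
by rewrite (sw_counit (coact_comodule M)
    (F := fun m0 => pure m0 v : btens)) //; lin.
Qed.

Let coact_act a t : btens_coact (btens_act a t) =
  tmul (fun a t => btens_act a t) (@kmul k H) (acoact A a) (btens_coact t).
Proof.
apply: (tens_ext (L := fun t => btens_coact (btens_act a t))
  (L' := fun t => tmul (fun a t => btens_act a t) (@kmul k H) (acoact A a)
           (btens_coact t))).
- by lin.
- by lin.
move=> m v; rewrite btens_actE !btens_coactE.
rewrite coact_act {1}/tmul tlift_tmul; try by move=> ?; lin.
apply: eq_tlift => a0 a1; rewrite tlift_tmul; try by move=> ?; lin.
apply: eq_tlift => m0 m1; apply: eq_tlift => v0 v1.
by rewrite btens_actE /kmul mulrA.
Qed.

Definition btens_rhm : relHopfMod A :=
  RelHopfMod act_linear act1 actM coact_comodule coact_act.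
End BTens.

Section BTensBimod.
Variables (k : comPzRingType) (H : hopfAlg k) (A B C : comodAlg H).
Variables (M : bimod A B) (N : bimod B C).
Local Notation pure := (tpure (ract M) (act N)).
Local Notation T := (btens_rhm M N).

Let ract_fun (c : C) : T -> T := tlift (fun m n => pure m (ract N c n)).
Let ract_bal c : balanced (ract M) (act N) (fun m n => pure m (ract N c n)).
Proof.
split=> [v|m|b m v]; [lin | lin |].
by rewrite -act_ract tpure_bal.
Qed.
Let ract_lin c : linear (ract_fun c). Proof. exact: tlift_linear. Qed.
Definition btens_ract (c : C) : {linear T -> T} := mklin (ract_lin c).

Lemma btens_ractE c m n : btens_ract c (pure m n) = pure m (ract N c n).
Proof. exact: (tliftE _ _ (ract_bal c)). Qed.

Let ract_linear t : linear (btens_ract^~ t).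
Proof. by apply: lin_tlift_f => m v; lin. Qed.

Let ract1 t : btens_ract 1 t = t.
Proof.
by rewrite -[RHS]tlift_pure; apply: eq_tlift => m v; rewrite ract1.
Qed.

Let ractM b c t : btens_ract (b * c) t = btens_ract c (btens_ract b t).
Proof.
apply: (tens_ext (L := btens_ract (b * c))
  (L' := fun t => btens_ract c (btens_ract b t))).
- exact: linearP.
- by lin.
- by move=> m v; rewrite !btens_ractE ractM.
Qed.

Let act_ract a c t : act T a (btens_ract c t) = btens_ract c (act T a t).
Proof.
apply: (tens_ext (L := fun t => act T a (btens_ract c t))
  (L' := fun t => btens_ract c (act T a t))).
- by lin.
- by lin.
- by move=> m v; rewrite /= !(btens_ractE, btens_actE).
Qed.

Let coact_ract c t : coact T (btens_ract c t) =
  tmul (fun t c => btens_ract c t) (@kmul k H) (coact T t) (acoact C c).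
Proof.
apply: (tens_ext (L := fun t => coact T (btens_ract c t))
  (L' := fun t => tmul (fun t c => btens_ract c t) (@kmul k H)
           (coact T t) (acoact C c))).
- by lin.
- by lin.
move=> m n; rewrite /= btens_ractE !btens_coactE.
rewrite coact_ract [RHS]tlift_tmul; try by move=> ?; lin.
apply: eq_tlift => m0 m1; rewrite tlift_tmul; try by move=> ?; lin.
apply: eq_tlift => n0 n1; apply: eq_tlift => c0 c1.
by rewrite btens_ractE /kmul mulrA.
Qed.

Definition btens_bimod : bimod A C :=
  Bimod ract_linear ract1 ractM act_ract coact_ract.
End BTensBimod.

Section Regular.
Variables (k : comPzRingType) (H : hopfAlg k) (A : comodAlg H).

Let act_linear (v : A) : linear (fun a : A => lmul a v).
Proof. by rewrite /lmul; lin. Qed.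
Let act1 (v : A) : lmul (1 : A) v = v. Proof. exact: mul1r. Qed.
Let actM (a b v : A) : lmul (a * b) v = lmul a (lmul b v).
Proof. by symmetry; exact: mulrA. Qed.
Let coact_act (a v : A) : acoact A (lmul a v) =
  tmul (fun a v => lmul a v) (@kmul k H) (acoact A a) (acoact A v).
Proof. exact: acoactM. Qed.
Definition reg_rhm : relHopfMod A :=
  RelHopfMod act_linear act1 actM (acoact_comodule A) coact_act.

Let ract_linear (v : reg_rhm) : linear (fun a : A => rmul a v).
Proof. by rewrite /rmul; lin. Qed.
Let ract1 (v : reg_rhm) : rmul (1 : A) v = v. Proof. exact: mulr1. Qed.
Let ractM (b c : A) (v : reg_rhm) : rmul (b * c) v = rmul c (rmul b v).
Proof. exact: mulrA. Qed.
Let act_ract (a b : A) (v : reg_rhm) :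
  act reg_rhm a (rmul b v) = rmul b (act reg_rhm a v).
Proof. exact: mulrA. Qed.
Let coact_ract (b : A) (v : reg_rhm) : coact reg_rhm (rmul b v) =
  tmul (fun v b => rmul b v) (@kmul k H) (coact reg_rhm v) (acoact A b).
Proof. exact: acoactM. Qed.
Definition reg_bimod : bimod A A :=
  @Bimod _ _ A A reg_rhm (@rmul k A) ract_linear ract1 ractM act_ract
    coact_ract.
End Regular.

Section TensorFunctor.
Variables (k : comPzRingType) (H : hopfAlg k) (A B : comodAlg H).
Variable M : bimod A B.
Local Notation F := (btens_rhm M).
Local Notation S' := (antipV H).

Section Morphism.
Variables (V W : relHopfMod B).
Let pV := tpure (ract M) (act V) : M -> V -> F V.
Let pW := tpure (ract M) (act W) : M -> W -> F W.

Definition btens_fun (f : ahom V W) : F V -> F W := tlift (fun m v => pW m (f v)).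

Lemma btens_fun_bal (f : ahom V W) :
  balanced (ract M) (act V) (fun m v => pW m (f v)).
Proof.
rewrite /pW; split=> [v|m|b m v]; [lin | lin |].
by rewrite tpure_bal (ahomP f).2.
Qed.
Lemma btens_funE (f : ahom V W) m v : btens_fun f (pV m v) = pW m (f v).
Proof. exact: (tliftE _ _ (btens_fun_bal f)). Qed.

Fact btens_ahom_subproof (f : ahom V W) : btens_fun f \in ahom_pred (F V) (F W).
Proof.
have L : linear (btens_fun f) := tlift_linear (btens_fun_bal f).
apply/asboolP; split=> [u v|a t]; first exact: (linD L).
apply: (tens_ext (L := fun t => btens_fun f (act (F V) a t))
  (L' := fun t => act (F W) a (btens_fun f t))).
- by apply: lin_comp L _; lin.
- by apply: lin_app.
by move=> m v; rewrite /= btens_actE !btens_funE btens_actE.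
Qed.
Definition btens_ahom (f : ahom V W) : ahom (F V) (F W) :=
  AHom (btens_ahom_subproof f).

Lemma btens_ahomE (f : ahom V W) m v :
  btens_ahom f (tpure (ract M) (act V) m v) = pW m (f v).
Proof. exact: btens_funE. Qed.

Fact btens_HOM_subproof (f : HOM V W) :
  btens_ahom f \in HOM_pred (F V) (F W).
Proof.
apply/asboolP; have [x hx] := HOMP f.
exists (tmap btens_ahom idfun x).
have evl t : linear (fun g : ahom V W => btens_ahom g t).
  by apply: lin_tlift_f => m v; apply: lin_pure_r; exact: ev_linear.
have E t : tmap (fun g : ahom (F V) (F W) => g t) idfun
    (tmap btens_ahom idfun x) =
    tlift (fun g h => btens_ahom g t ⊗ h) x.
  rewrite [LHS]tlift_tmap // => ?; last by lin.
  by apply: lin_pure_l; exact: ev_linear.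
move=> t; rewrite E.
apply: (tens_ext (L := fun t => tlift (fun g h => btens_ahom g t ⊗ h) x)
  (L' := fun t => tlift (fun m0 m1 => tmap idfun (kmul (S' m1))
     (coact (F W) (btens_ahom f m0))) (coact (F V) t))).
- by lin.
- by lin.
move=> m v; rewrite [coact (F V) _]btens_coactE tlift_tmul;
  try by move=> ?; lin.
transitivity (tlift (fun w h => pW m w ⊗ h)
    (tmap (fun g : ahom V W => g v) idfun x)).
  rewrite tlift_tmap; [|by rewrite /pW => ?; lin..].
  by apply: eq_tlift => g h; rewrite btens_ahomE.
rewrite hx (linear_tlift (L := tlift _)); last by rewrite /pW; lin.
transitivity (tlift (fun v0 (v1 : H) => tlift (fun m0 (m1 : H) =>
    tlift (fun m0' (m1' : H) => tlift (fun w0 (w1 : H) =>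
      pW m0' w0 ⊗ (S' (m1 * v1) * (m1' * w1) : H))
      (coact W (f v0))) (coact M m0)) (coact M m)) (coact V v)); last first.
  rewrite exchange_tlift; apply: eq_tlift => m0 m1; apply: eq_tlift => v0 v1.
  rewrite btens_ahomE [coact (F W) _]btens_coactE.
  by rewrite [RHS]tlift_tmul // => ?; lin.
apply: eq_tlift => v0 v1.
rewrite tlift_tmap; [|by rewrite /pW => ?; lin..].
pose G m0 (x y : H) := tlift (fun w0 (w1 : H) =>
  pW m0 w0 ⊗ (S' (y * v1) * (x * w1) : H)) (coact W (f v0)).
rewrite (sw_assoc (coact_comodule M) (F := G));
  try by [rewrite /G /pW => ? ?; lin].
pose K m := tlift (fun w0 (w1 : H) => pW m w0 ⊗ (S' v1 * w1 : H)) (coact W (f v0)).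
transitivity (tlift (fun m h => counit H h *: K m) (coact M m)).
  by rewrite (sw_counit (coact_comodule M) (F := K)) // /K /pW; lin.
apply: eq_tlift => m0 h; symmetry.
transitivity (tlift (fun a b : H => tlift (fun w0 (w1 : H) =>
   pW m0 w0 ⊗ (S' v1 * ((S' b * a) * w1) : H)) (coact W (f v0))) (comul H h)).
  apply: eq_tlift => a b; apply: eq_tlift => w0 w1.
  by rewrite antipVM !mulrA.
rewrite (sw_antipV_l (F := fun x : H => tlift (fun w0 (w1 : H) =>
   pW m0 w0 ⊗ (S' v1 * (x * w1) : H)) (coact W (f v0)))); last by lin.
by congr (_ *: _); apply: eq_tlift => w0 w1; rewrite mul1r.
Qed.
Definition btens_HOM (f : HOM V W) : HOM (F V) (F W) :=
  Hom (btens_HOM_subproof f).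
End Morphism.

Let fmap_id (V : HOMcat B) : btens_HOM (HOM_id V) = HOM_id (F V).
Proof. by apply: HOM_eqP => t; exact: tlift_pure. Qed.
Let fmap_comp (U V W : HOMcat B) (g : HOM V W) (f : HOM U V) :
  btens_HOM (HOM_comp g f) = HOM_comp (btens_HOM g) (btens_HOM f).
Proof.
have L (X Y : relHopfMod B) (h : HOM X Y) : linear (btens_HOM h).
  exact: (is_ahom_linear (ahomP (btens_HOM h))).
apply: HOM_eqP => t; apply: (tens_ext (L := btens_HOM (HOM_comp g f))
  (L' := fun t => btens_HOM g (btens_HOM f t))).
- exact: L.
- exact: lin_comp (L _ _ g) (L _ _ f).
by move=> m v; rewrite /= !btens_funE.
Qed.

Definition tensor_functor : functor (HOMcat B) (HOMcat A) :=
  @Functor (HOMcat B) (HOMcat A) F btens_HOM fmap_id fmap_comp.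
End TensorFunctor.

Section Morita.
Variables (k : comPzRingType) (H : hopfAlg k).

Record bimod_hom (A B : comodAlg H) (M N : bimod A B) := BimodHom {
  bh_fun :> M -> N;
  bh_act : forall a m, bh_fun (act M a m) = act N a (bh_fun m);
  bh_ract : forall b m, bh_fun (ract M b m) = ract N b (bh_fun m);
  bh_colinear : colinear (coact M) (coact N) bh_fun
}.

Variables (A B : comodAlg H).

Record morita_context := MoritaContext {
  mc_M : bimod A B;
  mc_N : bimod B A;
  mc_alpha : bimod_hom (btens_bimod mc_M mc_N) (reg_bimod A);
  mc_beta : bimod_hom (btens_bimod mc_N mc_M) (reg_bimod B);
  mc_alphaP : forall m n m',
    act mc_M (mc_alpha (tpure (ract mc_M) (act mc_N) m n)) m' =
    ract mc_M (mc_beta (tpure (ract mc_N) (act mc_M) n m')) m;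
  mc_betaP : forall n m n',
    act mc_N (mc_beta (tpure (ract mc_N) (act mc_M) n m)) n' =
    ract mc_N (mc_alpha (tpure (ract mc_M) (act mc_N) m n')) n
}.

Definition strict (X : morita_context) : Prop :=
  bijective (mc_alpha X) /\ bijective (mc_beta X).
End Morita.

(* Main.v *)
From HB Require Import structures.
Require Import Defs.
From mathcomp Require Import all_boot all_algebra.
From mathcomp Require Import boolp classical_sets functions fsbigop.
From mathcomp Require Import ring_quotient.

(** Let A and B stand for the regular relative Hopf modules, and let N = T(A).
    The maps a |-> a v identify HOM(A, V) with V as a comodule. In particular
    the endomorphisms of A are its right multiplications, and, since T is
    colinear, N becomes a (B, A)-bimodule with a compatible coaction.

    The key point is that N generates B and is finitely generated projective
    over B. Let I be the set of all finite sums of values of maps in HOM(N, B).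
    It is a left ideal and a subcomodule, so B / I is a relative Hopf module.
    The projection of B onto B / I kills every element of HOM(N, B). Since
    U(N) = U(T(A)) is isomorphic to A, its image under U kills every map from A
    to U(B), so it is zero; U being faithful, B / I = 0 ([trace_full]). Thus
    1 = \sum_q g_q(n_q) with g_q in HOM(N, B). The same statement for T writes
    1 in A as a sum of values of maps U(B) -> A; applying T turns it into a
    factorization of the identity of N as a sum of composites N -> B -> N,
    that is, a dual basis of N ([image_dual_basis]). As T is fully faithful, A
    is the full ring of B-endomorphisms of N, so N is a progenerator.

    Put M = Hom_B(N, B), with the coaction of HOM(N, B) and the usual bimodule
    structure. The evaluation and rank-one maps of classical Morita theory are
    colinear, which gives a strict context ([morita_strict]). The space U(B) is
    isomorphic to M, but the natural isomorphism between T U and the identity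
    need not be colinear; this is why M is built from N and not from U.

    The canonical map from N ⊗_A V to T(V) is colinear, and bijective because T
    is fully faithful and 1 is in the trace of N ([functor_iso_tensor]).
    Finally T (M ⊗_B -) is isomorphic to N ⊗_A (M ⊗_B -), hence to the identity
    and to T U, and T can be cancelled.

    Projectivity of H ensures that the components f_[0] of f in HOM lie again
    in HOM ([HOM_coactP]). Existence and uniqueness of f_[0] ⊗ f_[1] are
    handled through an equivalent equation without the antipode
    ([HOM_coact_eqP]). *)

Set Implicit Arguments.
Unset Strict Implicit.
Unset Printing Implicit Defensive.

Import GRing.Theory.
Local Open Scope ring_scope.
Local Open Scope quotient_scope.

Local Notation hom := Defs.hom.
Local Notation Hom := Defs.Hom.
Local Notation comp := Defs.comp.

(** * Linearity of evaluation *)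

Section AhomLinear.
Variables (k : comPzRingType) (H : hopfAlg k) (A : comodAlg H).
Variables (V W : relHopfMod A).

Lemma lin_ev (M : lmodType k) (g : M -> ahom V W) (v : V) :
  linear g -> linear (fun x => g x v).
Proof. by move=> hg c x y; rewrite hg ev_linear. Qed.

Lemma HOM_ahom_linear : linear (@HOM_ahom _ _ _ V W).
Proof. exact: (linearP (\val : HOM V W -> ahom V W)). Qed.

Lemma lin_evH (M : lmodType k) (g : M -> HOM V W) (v : V) :
  linear g -> linear (fun x => g x v).
Proof.
by move=> hg; apply: lin_ev => c x y; rewrite hg; exact: HOM_ahom_linear.
Qed.

Lemma lin_HOM_ahom (M : lmodType k) (g : M -> HOM V W) :
  linear g -> linear (fun x => HOM_ahom (g x)).
Proof. by move=> hg; apply: (lin_comp HOM_ahom_linear). Qed.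

Lemma lin_ahom_app (M : lmodType k) (f : ahom V W) (g : M -> V) :
  linear g -> linear (fun x => f (g x)).
Proof. by move=> hg c x y; rewrite hg linearP. Qed.
End AhomLinear.

(** Extends the tactic [lin] with evaluation and composition of A-linear maps,
    and with linearity facts found among the hypotheses. *)
Ltac slin := cbv beta delta [tmap tmul tassoc kmul idfun];
  first
  [ solve [exact: lin_id]
  | solve [exact: linearP]
  | assumption
  | solve [apply: antipV_linear]
  | solve [apply: lin_mul_l; slin]
  | solve [apply: lin_mul_r; slin]
  | solve [apply: lin_act_l; slin]
  | solve [apply: lin_ract_l; slin]
  | solve [apply: lin_pure_l; slin]
  | solve [apply: lin_pure_r; slin]
  | solve [apply: lin_tlift_f; intros ? ?; slin]
  | solve [apply: lin_tlift; [sbal | slin]]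
  | solve [apply: (lin_comp (@antipV_linear _ _)); slin]
  | solve [apply: lin_ev; slin]
  | solve [apply: lin_evH; slin]
  | solve [apply: lin_HOM_ahom; slin]
  | solve [apply: lin_app; slin]
  | solve [apply: lin_ahom_app; slin]
  | solve [exact: lin_scalar]
  | solve [apply: lin_scal; slin]
  | multimatch goal with h : _ |- _ =>
     solve [apply: (lin_comp h); slin | apply: h ] end ]
with sbal := apply: kbalanced; intros ?; slin.

(** * Functions on a comodule twisted by its coaction *)

Section TensorMapTheory.
Variables (k : comPzRingType) (M N M' N' : lmodType k).
Variables (f : M -> M') (g : N -> N').
Hypotheses (hf : linear f) (hg : linear g).

Lemma tmap_balanced :
  balanced (@scal k M) (@scal k N) (fun m n => f m ⊗ g n).
Proof. by apply: kbalanced => ?; slin. Qed.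

Lemma tmapE m n : tmap f g (m ⊗ n) = f m ⊗ g n.
Proof. exact: tliftE tmap_balanced. Qed.

Lemma tmap_linear : linear (tmap f g).
Proof. exact: tlift_linear tmap_balanced. Qed.
End TensorMapTheory.

Section Twist.
Variables (k : comPzRingType) (H : hopfAlg k).
Variables (V : lmodType k) (rho : {linear V -> (V ⊗ H)%type}).
Hypothesis hrho : is_comodule rho.
Variables (P : lmodType k).
Local Notation S' := (antipV H).

(** For phi(v) = x_[0](v) ⊗ x_[1] the defining equation of f_[0] ⊗ f_[1] says
    that phi is the untwist of rho o f. It is equivalent to say that rho o f is
    the twist of phi, i.e. rho(f(v)) = f_[0](v_[0]) ⊗ v_[1] f_[1], a form in
    which the antipode does not occur. *)
Definition twist (phi : V -> P ⊗ H) (v : V) : P ⊗ H :=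
  tlift (fun v0 v1 => tmap idfun (kmul v1) (phi v0)) (rho v).

Definition untwist (phi : V -> P ⊗ H) (v : V) : P ⊗ H :=
  tlift (fun v0 v1 => tmap idfun (kmul (S' v1)) (phi v0)) (rho v).

Lemma tmap_kmulM (g h : H) (t : P ⊗ H) :
  tmap idfun (kmul g) (tmap idfun (kmul h) t) = tmap idfun (kmul (g * h)) t.
Proof.
rewrite [LHS]tlift_tmap; try by move=> ?; slin.
by apply: eq_tlift => p x; rewrite /kmul mulrA.
Qed.

Lemma tmap_kmul1 (t : P ⊗ H) : tmap idfun (kmul 1) t = t.
Proof.
by rewrite -[RHS]tlift_pure; apply: eq_tlift => p x; rewrite /kmul mul1r.
Qed.

(** The two operations cancel because S^-1(v_[2]) v_[1] = eps(v_[1]) 1, and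
    in the other order because v_[2] S^-1(v_[1]) = eps(v_[1]) 1. *)
Lemma twistK (phi : V -> P ⊗ H) : linear phi -> untwist (twist phi) =1 phi.
Proof.
move=> hphi v; rewrite /untwist /twist.
transitivity (tlift (fun v0 (h : H) => tlift (fun v' (h' : H) =>
   tmap idfun (kmul (S' h * h')) (phi v')) (rho v0)) (rho v)).
  apply: eq_tlift => v0 h; rewrite (linear_tlift (L := tmap _ _)); last by slin.
  by apply: eq_tlift => v1 h1; rewrite tmap_kmulM.
rewrite (sw_assoc hrho (F := fun v' (h' h : H) =>
  tmap idfun (kmul (S' h * h')) (phi v')));
  try by move=> ? ?; slin.
rewrite -(sw_counit hrho (F := phi)) //; apply: eq_tlift => v0 h.
rewrite (sw_antipV_l (F := fun x => tmap idfun (kmul x) (phi v0)));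
  last by slin.
by rewrite tmap_kmul1.
Qed.

Lemma untwistK (phi : V -> P ⊗ H) : linear phi -> twist (untwist phi) =1 phi.
Proof.
move=> hphi v; rewrite /untwist /twist.
transitivity (tlift (fun v0 (h : H) => tlift (fun v' (h' : H) =>
   tmap idfun (kmul (h * S' h')) (phi v')) (rho v0)) (rho v)).
  apply: eq_tlift => v0 h; rewrite (linear_tlift (L := tmap _ _)); last by slin.
  by apply: eq_tlift => v1 h1; rewrite tmap_kmulM.
rewrite (sw_assoc hrho (F := fun v' (h' h : H) =>
  tmap idfun (kmul (h * S' h')) (phi v')));
  try by move=> ? ?; slin.
rewrite -(sw_counit hrho (F := phi)) //; apply: eq_tlift => v0 h.
rewrite (sw_antipV_r (F := fun x => tmap idfun (kmul x) (phi v0)));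
  last by slin.
by rewrite tmap_kmul1.
Qed.

(** Identities in P ⊗ H that depend on v in V may thus be checked after
    twisting; this cancels an unwanted factor v_[1]. *)
Lemma twist_inj (phi psi : V -> P ⊗ H) : linear phi -> linear psi ->
  twist phi =1 twist psi -> phi =1 psi.
Proof.
move=> hphi hpsi E v; rewrite -(twistK hphi) -(twistK hpsi).
by apply: eq_tlift => v0 v1; rewrite E.
Qed.
End Twist.

(** * Tensors with a projective factor *)

Section FiniteSupport.
Variables (k : comPzRingType) (P : lmodType k).

Definition fsupp_pred : {pred P -> k^o} :=
  [pred f | `[< exists s : seq P, forall h, h \notin s -> f h = 0 >]].

Fact fsupp_closed : submod_closed fsupp_pred.
Proof.
split=> [|c f g /asboolP[s hs] /asboolP[t ht]].
  by apply/asboolP; exists [::].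
apply/asboolP; exists (s ++ t) => h; rewrite mem_cat => /norP[/hs fh /ht gh].
by rewrite !(addrfctE, scalrfctE) /= fh gh scaler0 addr0.
Qed.
HB.instance Definition _ :=
  GRing.isSubmodClosed.Build k (P -> k^o) fsupp_pred fsupp_closed.

(** The free k-module on the set P. *)
Record fsupp := Fsupp { fsupp_fun :> P -> k^o; _ : fsupp_fun \in fsupp_pred }.
HB.instance Definition _ := [isSub for fsupp_fun].
HB.instance Definition _ := [Choice of fsupp by <:].
HB.instance Definition _ := [SubChoice_isSubLmodule of fsupp by <:].

Lemma fsuppE c (f g : fsupp) h : (c *: f + g) h = c * f h + g h.
Proof.
by have /(congr1 (@^~ h)) := linearP (\val : fsupp -> P -> k^o) c f g.
Qed.

Lemma fsupp_finite (f : fsupp) :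
  exists s : seq P, forall h, h \notin s -> f h = 0.
Proof. by case: f => f /= /asboolP. Qed.

Lemma fsuppP (l : seq fsupp) :
  exists s : seq P, uniq s /\ forall f h, f \in l -> h \notin s -> f h = 0.
Proof.
elim: l => [|f l [s [_ hs]]]; first by exists [::].
have [t ht] := fsupp_finite f; exists (undup (t ++ s)).
split=> [|g h]; first exact: undup_uniq.
rewrite mem_undup mem_cat inE => /orP[/eqP-> /norP[/ht //]|gl /norP[_]].
exact: hs.
Qed.

Definition fsupp_sum (f : fsupp) : P := \sum_(h \in setT) f h *: h.

Lemma fsupp_sumE (f : fsupp) (s : seq P) : uniq s ->
  (forall h, h \notin s -> f h = 0) -> fsupp_sum f = \sum_(h <- s) f h *: h.
Proof.
move=> us hs; rewrite /fsupp_sum (fsbigE _ _ us) => [|//|h _ /hs ->].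
  by apply: eq_bigl => h; rewrite in_setT.
by rewrite scale0r.
Qed.

Lemma fsupp_sum_linear : linear fsupp_sum.
Proof.
move=> c f g; have [s [us hs]] := fsuppP [:: f; g; c *: f + g].
rewrite !(@fsupp_sumE _ s) //;
  try by move=> h; apply: hs; rewrite !inE eqxx ?orbT.
rewrite scaler_sumr -big_split; apply: eq_bigr => h _.
by rewrite fsuppE scalerDl -scalerA.
Qed.

Lemma fsupp_delta_subproof (p : P) : (fun h => (h == p)%:R) \in fsupp_pred.
Proof. by apply/asboolP; exists [:: p] => h; rewrite inE => /negPf->. Qed.
Lemma fsupp_sum_surj (p : P) : exists f, fsupp_sum f = p.
Proof.
exists (Fsupp (fsupp_delta_subproof p)); rewrite (@fsupp_sumE _ [:: p]) //=.
  by rewrite big_seq1 eqxx scale1r.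
by move=> h; rewrite inE => /negPf->.
Qed.

(** A section of the surjection from the free module on P onto P has coordinate
    functionals p_i, for which x = \sum_i p_i(x) i. Only finitely many of them
    are nonzero on the finitely many elements of P that occur in a given
    tensor. *)
Lemma projective_tens_expand (M : lmodType k) (x : M ⊗ P) : projective P ->
  exists s : seq (P * {scalar P}),
    x = \sum_(q <- s) tlift (fun m h => q.2 h *: m) x ⊗ q.1.
Proof.
move=> hP.
have [u hu] :=
  hP _ _ (mklin fsupp_sum_linear) (mklin (@lin_id _ P)) fsupp_sum_surj.
have coef_lin (i : P) : scalar (fun h : P => u h i : k).
  by move=> c h h'; rewrite linearP fsuppE.
pose coef i : {scalar P} := HB.pack (fun h : P => u h i : k)
  (GRing.isLinear.Build k P k *%R _ (coef_lin i)).
have [s [us hs]] := fsuppP [seq u q.2 | q <- repr x].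
exists [seq (i, coef i) | i <- s].
rewrite big_map /= {1}(tens_sum x).
have slice i : tlift (fun m h => coef i h *: m) x ⊗ i =
    \sum_(q <- repr x) (coef i q.2 *: q.1) ⊗ i.
  by rewrite (linsum (tpure_lin_l _ _ _)).
under [RHS]eq_bigr do rewrite slice.
rewrite exchange_big /= !big_seq; apply: eq_bigr => q qx.
under eq_bigr do rewrite tpure_scal.
rewrite -(linsum (tpure_lin_r _ _ _)); congr (_ ⊗ _).
rewrite -fsupp_sumE //.
by move=> h; apply: hs; apply: map_f.
Qed.
End FiniteSupport.

(** * The coaction on HOM *)

Section HOMCoaction.
Variables (k : comPzRingType) (H : hopfAlg k) (A : comodAlg H).
Variables (V W : relHopfMod A).
Implicit Types (f : ahom V W) (x : (ahom V W ⊗ H)%type).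

Lemma tmap_ev_linear x :
  linear (fun m : V => tmap (fun g : ahom V W => g m) (@idfun H) x).
Proof. by slin. Qed.

(** This is the antipode-free form of the equation that defines
    f_[0] ⊗ f_[1]; all later computations use it. *)
Lemma HOM_coact_eqP f x : HOM_coact_eq f x <->
  forall m, coact W (f m) =
    tlift (fun m0 (m1 : H) => tlift (fun (g : ahom V W) (h : H) =>
      g m0 ⊗ (m1 * h : H)) x) (coact V m).
Proof.
have evE m : tlift (fun m0 (m1 : H) => tlift (fun (g : ahom V W) (h : H) =>
    g m0 ⊗ (m1 * h : H)) x) (coact V m) =
    twist (coact V) (fun m => tmap (fun g : ahom V W => g m) idfun x) m.
  apply: eq_tlift => m0 m1; rewrite [RHS]tlift_tmap //; by move=> ?; slin.
have flin : linear (fun m => coact W (f m)) by slin.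
split=> [fx m|fx].
  rewrite evE -[LHS](untwistK (coact_comodule V) flin).
  by apply: eq_tlift => m0 m1; congr (tmap _ _ _); exact/esym/fx.
move=> m; rewrite -[LHS](twistK (coact_comodule V) (tmap_ev_linear x)).
by apply: eq_tlift => m0 m1; rewrite fx evE.
Qed.

Lemma sw_HOM (P : lmodType k) (F : W -> H -> P) f x m : HOM_coact_eq f x ->
  (forall h, linear (F^~ h)) -> (forall w, linear (F w)) ->
  tlift F (coact W (f m)) =
  tlift (fun m0 (m1 : H) => tlift (fun (g : ahom V W) (h : H) =>
    F (g m0) (m1 * h : H)) x) (coact V m).
Proof.
move=> /HOM_coact_eqP fx F1 F2; have bF := kbalanced F1 F2.
rewrite fx (linear_tlift (L := tlift F)); last exact: tlift_linear.
apply: eq_tlift => m0 m1.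
rewrite (linear_tlift (L := tlift F)); last exact: tlift_linear.
by apply: eq_tlift => g h; rewrite tliftE.
Qed.

(** Coassociativity of f_[0] ⊗ f_[1] before it is known that the f_[0] lie in
    HOM: f_[0](m)_[0] ⊗ f_[0](m)_[1] ⊗ f_[1] equals
    f_[0](m_[0]) ⊗ m_[1] f_[1] ⊗ f_[2]. After twisting in m, both sides become
    the two iterated coactions of f(m). *)
Lemma sw_HOM_assoc f x m : HOM_coact_eq f x ->
  tlift (fun (g : ahom V W) (h : H) => coact W (g m) ⊗ h) x =
  tlift (fun (g : ahom V W) (h : H) => tlift (fun h1 h2 : H =>
    tlift (fun m0 (m1 : H) =>
    (g m0 ⊗ (m1 * h1 : H)) ⊗ h2) (coact V m)) (comul H h)) x.
Proof.
move=> fx.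
pose phi m := tlift (fun (g : ahom V W) h => coact W (g m) ⊗ h) x.
pose psi m := tlift (fun (g : ahom V W) (h : H) => tlift (fun h1 h2 : H =>
    tlift (fun m0 (m1 : H) =>
    (g m0 ⊗ (m1 * h1 : H)) ⊗ h2) (coact V m)) (comul H h)) x.
suff: phi =1 psi by apply.
apply: (twist_inj (coact_comodule V)); rewrite /phi /psi; [slin | slin |].
move=> {}m.
transitivity (tlift (fun w (h : H) => coact W w ⊗ h) (coact W (f m))).
  rewrite (sw_HOM _ fx); try by move=> ?; slin.
  apply: eq_tlift => m0 m1; rewrite (linear_tlift (L := tmap _ _)); last by slin.
  by apply: eq_tlift => g h; rewrite tmapE //; slin.
transitivity (tlift (fun w h =>
   tlift (fun w0 (w1 : H) => (w0 ⊗ w1) ⊗ h) (coact W w))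
   (coact W (f m))).
  apply: eq_tlift => w h.
  rewrite -{1}[coact W w]tlift_pure (linear_tlift (L := fun y => y ⊗ h)) //; slin.
rewrite (sw_assoc (coact_comodule W) (F := fun w0 w1 h => (w0 ⊗ w1) ⊗ h));
  try by move=> ? ?; slin.
rewrite (sw_HOM _ fx); try by move=> ?; slin.
pose G m0 (a b : H) := tlift (fun (g : ahom V W) (h : H) => tlift (fun h1 h2 : H =>
   (g m0 ⊗ (a * h1 : H)) ⊗ (b * h2 : H)) (comul H h)) x.
transitivity (tlift (fun m0 (m1 : H) => tlift (fun a b => G m0 a b) (comul H m1))
   (coact V m)).
  apply: eq_tlift => m0 m1; rewrite [RHS]exchange_tlift; apply: eq_tlift => g h.
  by rewrite sw_comulM //; move=> ?; slin.
rewrite -(sw_assoc (coact_comodule V) (F := G)); try by rewrite /G; move=> ? ?; slin.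
apply: eq_tlift => m0 m1.
transitivity (tlift (fun (g : ahom V W) (h : H) => tlift (fun h1 h2 : H =>
   tlift (fun m0' (m1' : H) =>
   (g m0' ⊗ (m1' * h1 : H)) ⊗ (m1 * h2 : H)) (coact V m0)) (comul H h)) x).
  rewrite exchange_tlift; apply: eq_tlift => g h.
  by rewrite exchange_tlift.
rewrite [RHS](linear_tlift (L := tmap _ _)); last by slin.
apply: eq_tlift => g h.
rewrite [RHS](linear_tlift (L := tmap _ _)); last by slin.
apply: eq_tlift => h1 h2.
rewrite [RHS](linear_tlift (L := tmap _ _)); last by slin.
apply: eq_tlift => m0' m1'.
by rewrite tmapE //; slin.
Qed.

(** By the preceding identity p(f_[1]) f_[0] has the coaction
    f_[0] ⊗ f_[1] p(f_[2]). *)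
Lemma HOM_slice f x (p : {scalar H}) : HOM_coact_eq f x ->
  tlift (fun (g : ahom V W) (h : H) => p h *: g) x \in HOM_pred V W.
Proof.
move=> fx; apply/asboolP.
exists (tlift (fun (g : ahom V W) (h : H) =>
  tlift (fun h1 h2 : H => p h2 *: (g ⊗ h1)) (comul H h)) x).
apply/HOM_coact_eqP => m.
have L : linear (fun g : ahom V W => coact W (g m)) by slin.
rewrite (linear_tlift (L := fun g : ahom V W => coact W (g m))) //.
transitivity (tlift (fun y h => p h *: y)
    (tlift (fun (g : ahom V W) (h : H) => coact W (g m) ⊗ h) x)).
  rewrite [RHS](linear_tlift (L := tlift _)); last by slin.
  apply: eq_tlift => g h; rewrite tliftE; last by sbal.
  exact: (linZ L).
rewrite (sw_HOM_assoc _ fx) (linear_tlift (L := tlift _)); last by slin.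
transitivity (tlift (fun (m0 : V) (m1 : H) => tlift (fun (g : ahom V W) (h : H) =>
   tlift (fun h1 h2 : H => p h2 *: (g m0 ⊗ (m1 * h1 : H))) (comul H h)) x)
   (coact V m)).
  rewrite [RHS]exchange_tlift; apply: eq_tlift => g h; rewrite [RHS]exchange_tlift.
  rewrite (linear_tlift (L := tlift _)); last by slin.
  apply: eq_tlift => h1 h2.
  rewrite (linear_tlift (L := tlift _)); last by slin.
  apply: eq_tlift => m0 m1.
  by rewrite tliftE //; sbal.
apply: eq_tlift => m0 m1.
rewrite [RHS](linear_tlift (L := tlift _)); last by slin.
apply: eq_tlift => g h.
rewrite [RHS](linear_tlift (L := tlift _)); last by slin.
apply: eq_tlift => h1 h2.
have G : linear (tlift (fun (g : ahom V W) (h : H) => g m0 ⊗ (m1 * h : H))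
  : (ahom V W ⊗ H)%type -> (W ⊗ H)%type) by slin.
by rewrite (linZ G) tliftE //; sbal.
Qed.

(** The chosen value of the coaction is the right one as soon as there is a
    right one. *)
Lemma HOM_coact_spec (f : HOM V W) (y : (HOM V W ⊗ H)%type) :
  HOM_coact_eq f (tmap (@HOM_ahom _ _ _ V W) idfun y) ->
  HOM_coact_eq f (tmap (@HOM_ahom _ _ _ V W) idfun (HOM_coact f)).
Proof.
move=> hy.
exact: (xgetPex 0 (P := [set x | HOM_coact_eq f (tmap _ idfun x)]%classic)
  (ex_intro _ y hy)).
Qed.

Hypothesis H_projective : projective H.

(** The element f_[0] ⊗ f_[1] is given in ahom ⊗ H. When H is projective it
    can be expanded into its slices, so it comes from HOM ⊗ H. *)
Lemma HOM_coactP (f : HOM V W) :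
  HOM_coact_eq f (tmap (@HOM_ahom _ _ _ V W) idfun (HOM_coact f)).
Proof.
have [x fx] := HOMP f; have [s xE] := projective_tens_expand x H_projective.
apply: (@HOM_coact_spec _ (\sum_(q <- s) (Hom (HOM_slice q.2 fx) ⊗ q.1))).
rewrite (linsum (tmap_linear _ _)); [|slin..].
rewrite (_ : \sum_(q <- s) _ = x) // [RHS]xE.
by apply: eq_bigr => q _; rewrite tmapE //; slin.
Qed.

Lemma sw_HOM_coact (P : lmodType k) (F : W -> H -> P) (f : HOM V W) m :
  (forall h, linear (F^~ h)) -> (forall w, linear (F w)) ->
  tlift F (coact W (f m)) =
  tlift (fun m0 (m1 : H) => tlift (fun (g : HOM V W) (h : H) =>
    F (g m0) (m1 * h : H)) (HOM_coact f)) (coact V m).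
Proof.
move=> F1 F2; rewrite (sw_HOM _ (HOM_coactP f)) //.
apply: eq_tlift => m0 m1; rewrite tlift_tmap // => [h|g].
  by apply: (lin_comp (F1 _)); slin.
by apply: (lin_comp (F2 _)); slin.
Qed.
End HOMCoaction.

(** * Maps out of the regular module *)

Section RegularMaps.
Variables (k : comPzRingType) (H : hopfAlg k) (A : comodAlg H).
Variable V : relHopfMod A.
Local Notation R := (reg_rhm A).

(** The maps a |-> a v identify V with HOM(A, V), also as a comodule. *)
Fact orbit_ahom_subproof (v : V) : (fun a : R => act V a v) \in ahom_pred R V.
Proof.
apply/asboolP; split=> [a b|a b]; first exact: (linD (act_linear v)).
exact: actM.
Qed.
Definition orbit_ahom (v : V) : ahom R V := AHom (orbit_ahom_subproof v).

Lemma orbit_ahom_linear : linear orbit_ahom.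
Proof.
move=> c v w; apply: ahom_eqP => a; rewrite [RHS]ev_linear /=.
exact: linearP.
Qed.

Lemma orbit_coact_eq (v : V) :
  HOM_coact_eq (orbit_ahom v) (tmap orbit_ahom idfun (coact V v)).
Proof.
have L := orbit_ahom_linear.
apply/HOM_coact_eqP => a; rewrite [LHS]coact_act.
apply: eq_tlift => a0 a1; rewrite tlift_tmap //; by move=> ?; slin.
Qed.

Fact orbit_subproof (v : V) : orbit_ahom v \in HOM_pred R V.
Proof.
apply/asboolP; exists (tmap orbit_ahom idfun (coact V v)).
exact: orbit_coact_eq.
Qed.
Definition orbit (v : V) : HOM R V := Hom (orbit_subproof v).

Lemma orbit_linear : linear orbit.
Proof. move=> c v w; apply/val_inj; exact: orbit_ahom_linear. Qed.

Lemma ahom_orbit (f : ahom R V) : f = orbit_ahom (f 1).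
Proof.
apply: ahom_eqP => a /=; rewrite -(ahomP f).2; congr (f _).
exact/esym/mulr1.
Qed.

Lemma HOM_orbit (f : HOM R V) : f = orbit (f 1).
Proof. by apply/val_inj; exact: ahom_orbit. Qed.

Lemma orbit1 (v : V) : orbit v 1 = v.
Proof. exact: act1. Qed.

(** Evaluation at 1 makes HOM(A, V) ⊗ H isomorphic to V ⊗ H, so the
    element f_[0] ⊗ f_[1] of HOM(A, V) ⊗ H is determined by its value at 1. *)
Lemma HOM_coact_orbit (v : V) :
  HOM_coact (orbit v) = tmap orbit idfun (coact V v).
Proof.
have L := orbit_linear; have La := orbit_ahom_linear.
have ev1K (x : (HOM R V ⊗ H)%type) : tmap orbit idfun
    (tmap (fun g : ahom R V => g 1) idfun (tmap (@HOM_ahom _ _ _ R V) idfun x)) = x.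
  rewrite -[RHS]tlift_pure [LHS]tlift_tmap; try by move=> ?; slin.
  rewrite tlift_tmap; try by move=> ?; slin.
  by apply: eq_tlift => g h; rewrite -HOM_orbit.
have orbitE : HOM_coact_eq (orbit v)
    (tmap (@HOM_ahom _ _ _ R V) idfun (tmap orbit idfun (coact V v))).
  rewrite [tmap _ _ (tmap _ _ _)]tlift_tmap; try by move=> ?; slin.
  exact: orbit_coact_eq.
have /(_ 1) := HOM_coact_spec orbitE; rewrite -(orbitE 1).
move=> /(congr1 (tmap orbit idfun)).
by rewrite !ev1K.
Qed.

End RegularMaps.

Lemma comp_orbit (k : comPzRingType) (H : hopfAlg k) (A : comodAlg H)
    (V W : relHopfMod A) (f : HOM V W) (v : V) :
  HOM_comp f (orbit v) = orbit (f v).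
Proof. by rewrite [LHS]HOM_orbit; congr orbit; congr (f _); exact: orbit1. Qed.

(** * The image of the regular module under a colinear functor *)

Section FunctorBimodule.
Variables (k : comPzRingType) (H : hopfAlg k) (A B : comodAlg H).
Variable T : functor (HOMcat A) (HOMcat B).
Hypothesis T_colinear : colinear_functor T.
Hypothesis H_projective : projective H.

Definition fun_map (V W : relHopfMod A) (f : HOM V W) : HOM (T V) (T W) :=
  fmap T f.

Lemma fun_map_linear V W : linear (@fun_map V W).
Proof. exact: (T_colinear V W).1. Qed.

Lemma fun_map_comp (V W X : relHopfMod A) (g : HOM W X) (f : HOM V W) (t : T V) :
  fun_map (HOM_comp g f) t = fun_map g (fun_map f t).
Proof. exact: (congr1 (fun h : HOM (T V) (T X) => h t) (fmap_comp T g f)). Qed.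

Lemma fun_map_id (V : relHopfMod A) (t : T V) : fun_map (HOM_id V) t = t.
Proof. exact: (congr1 (fun h : HOM (T V) (T V) => h t) (fmap_id T V)). Qed.

(** Colinearity of T transports the coaction v_[0] ⊗ v_[1] of a |-> a v. For
    V = A this is the compatibility of the right action of A on T(A) with the
    coactions; for general V it makes n ⊗ v |-> T(a |-> a v)(n) colinear. *)
Lemma coact_fun_orbit (V : relHopfMod A) (v : V) (n : T (reg_rhm A)) :
  coact (T V) (fun_map (orbit v) n) =
  tmul (fun n v => fun_map (orbit v) n) (@kmul k H) (coact (T (reg_rhm A)) n)
    (coact V v).
Proof.
have LT := @fun_map_linear (reg_rhm A) V; have Lo := @orbit_linear _ _ A V.
have /HOM_coact_eqP -> := HOM_coactP H_projective (fun_map (orbit v)).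
have -> : HOM_coact (fun_map (orbit v)) =
    tmap (fun v => fun_map (orbit v)) idfun (coact V v).
  rewrite ((T_colinear _ _).2 (orbit v)) HOM_coact_orbit.
  by rewrite [LHS]tlift_tmap //; move=> ?; slin.
apply: eq_tlift => n0 n1.
rewrite tlift_tmap; try by move=> ?; slin.
rewrite tlift_tmap //; by move=> ?; slin.
Qed.

Local Notation N := (T (reg_rhm A) : relHopfMod B).

Definition fun_ract (a : A) : {linear N -> N} := fun_map (orbit (a : reg_rhm A)).

Let ract_linear (n : N) : linear (fun_ract^~ n).
Proof.
have LT := @fun_map_linear (reg_rhm A) (reg_rhm A).
have Lo := @orbit_linear _ _ A (reg_rhm A).
exact: (lin_evH n (lin_comp LT Lo)).
Qed.
Let ract1 (n : N) : fun_ract 1 n = n.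
Proof.
rewrite -[RHS]fun_map_id; congr (fun_map _ _).
by apply: HOM_eqP => a; exact: mulr1.
Qed.
Let ractM (b c : A) (n : N) : fun_ract (b * c) n = fun_ract c (fun_ract b n).
Proof.
rewrite -[RHS]fun_map_comp; congr (fun_map _ _).
by apply: HOM_eqP => a; exact: mulrA.
Qed.
Let act_ract (b : B) (a : A) (n : N) :
  act N b (fun_ract a n) = fun_ract a (act N b n).
Proof. exact/esym/(ahomP (fun_map _)).2. Qed.
Let coact_ract (a : A) (n : N) : coact N (fun_ract a n) =
  tmul (fun n a => fun_ract a n) (@kmul k H) (coact N n) (acoact A a).
Proof. exact: (coact_fun_orbit (a : reg_rhm A) n). Qed.

Definition fun_bimod : bimod B A :=
  @Bimod _ _ B A N fun_ract ract_linear ract1 ractM act_ract coact_ract.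
End FunctorBimodule.

(** * Quotients of relative Hopf modules *)

Section QuotientModule.
Variables (k : comPzRingType) (V : lmodType k).

(** Carries the closure proof in its type, so that the canonical structure of
    a submodule can be attached to an arbitrary predicate. *)
Definition mksub (p : {pred V}) of submod_closed p : {pred V} := p.
HB.instance Definition _ (p : {pred V}) (hp : submod_closed p) :=
  GRing.isSubmodClosed.Build k V (mksub hp) hp.

Variables (p : {pred V}) (hp : submod_closed p).
Local Notation I := (mksub hp).

Definition quot := Quotient.quot I.
HB.instance Definition _ := GRing.Zmodule.on quot.
HB.instance Definition _ := EqQuotient.on quot.

Definition qpi (v : V) : quot := \pi_quot v.

Lemma qpi_eqP u v : qpi u = qpi v <-> u - v \in I.
Proof. by rewrite Quotient.idealrBE; split=> [uv|/eqP //]; exact/eqP. Qed.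

Lemma qpiK (q : quot) : qpi (repr q) = q.
Proof. exact: reprK. Qed.

Lemma repr_qpi v : repr (qpi v) - v \in I.
Proof. by apply/qpi_eqP; exact: qpiK. Qed.

Definition quot_scale (c : k) (q : quot) : quot := qpi (c *: repr q).

Lemma quot_scaleE c v : quot_scale c (qpi v) = qpi (c *: v).
Proof. by apply/qpi_eqP; rewrite -scalerBr rpredZ // repr_qpi. Qed.

Lemma qpiD : {morph qpi : u v / u + v}.
Proof. by move=> u v; rewrite /qpi pi_addr. Qed.

Let scaleA c d q : quot_scale c (quot_scale d q) = quot_scale (c * d) q.
Proof. by rewrite -[q]qpiK !quot_scaleE scalerA. Qed.
Let scale1 : left_id 1 quot_scale.
Proof. by move=> q; rewrite -[q]qpiK quot_scaleE scale1r. Qed.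
Let scaleDr : right_distributive quot_scale +%R.
Proof.
by move=> c x y; rewrite -[x]qpiK -[y]qpiK -qpiD !quot_scaleE scalerDr qpiD.
Qed.
Let scaleDl q : {morph quot_scale^~ q : c d / c + d}.
Proof. by move=> c d; rewrite -[q]qpiK !quot_scaleE scalerDl qpiD. Qed.
HB.instance Definition _ := GRing.Zmodule_isLmodule.Build k quot
  scaleA scale1 scaleDr scaleDl.

Lemma qpi_linear : linear qpi.
Proof. by move=> c u v; rewrite qpiD -quot_scaleE. Qed.

Lemma qpi_eq0 v : qpi v = 0 <-> v \in I.
Proof. by rewrite -(lin0 qpi_linear) qpi_eqP subr0. Qed.

Section Lift.
Variables (P : lmodType k) (f : V -> P).
Hypotheses (f_lin : linear f) (fI : forall v, v \in I -> f v = 0).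

Definition quot_lift (q : quot) : P := f (repr q).

Lemma quot_liftE v : quot_lift (qpi v) = f v.
Proof.
apply/eqP; rewrite -subr_eq0; apply/eqP.
by rewrite /quot_lift -(fI (repr_qpi v)) -(raddfB (mklin f_lin)).
Qed.

Lemma quot_lift_linear : linear quot_lift.
Proof.
by move=> c x y; rewrite -[x]qpiK -[y]qpiK -qpi_linear !quot_liftE f_lin.
Qed.
End Lift.
End QuotientModule.

Section QuotientHopfModule.
Variables (k : comPzRingType) (H : hopfAlg k) (A : comodAlg H).
Variables (V : relHopfMod A) (p : {pred V}) (I : submod_closed p).
Hypothesis I_act : forall a v, v \in p -> act V a v \in p.
(* The kernel of V ⊗ H -> (V / I) ⊗ H is the image of I ⊗ H, so this says that
   the submodule is a subcomodule. *)
Hypothesis I_coact :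
  forall v, v \in p -> tmap (@qpi k V p I) idfun (coact V v) = 0.
Local Notation Q := (quot I).
Local Notation pi := (@qpi k V p I).

Let pi_lin : linear pi := @qpi_linear k V p I.

Let qact_lin a : linear (fun v : V => pi (act V a v)).
Proof. by slin. Qed.
Let qactI a v : v \in p -> pi (act V a v) = 0.
Proof. by move=> vI; apply/qpi_eq0/I_act. Qed.
Definition qact (a : A) : {linear Q -> Q} :=
  mklin (quot_lift_linear (qact_lin a) (qactI a)).
Lemma qactE a v : qact a (pi v) = pi (act V a v).
Proof. exact: (quot_liftE (qact_lin a) (qactI a)). Qed.

Let qcoact_lin : linear (fun v : V => tmap pi idfun (coact V v)).
Proof. by slin. Qed.
Definition qcoact : {linear Q -> (Q ⊗ H)%type} :=
  mklin (quot_lift_linear qcoact_lin I_coact).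
Lemma qcoactE v : qcoact (pi v) = tmap pi idfun (coact V v).
Proof. exact: (quot_liftE qcoact_lin I_coact). Qed.

Let act_linear q : linear (qact^~ q).
Proof.
by move=> c a b; rewrite -[q]qpiK !qactE act_linear pi_lin.
Qed.
Let act1 q : qact 1 q = q.
Proof. by rewrite -[q]qpiK qactE act1. Qed.
Let actM a b q : qact (a * b) q = qact a (qact b q).
Proof. by rewrite -[q]qpiK !qactE actM. Qed.

Let coact_comodule : is_comodule qcoact.
Proof.
split=> q; rewrite -[q]qpiK qcoactE.
  transitivity (tmap pi idfun (tassoc (tmap (coact V) idfun (coact V (repr q))))).
    rewrite [tmap qcoact _ _]tlift_tmap; try by move=> ?; slin.
    rewrite [LHS](linear_tlift (L := @tassoc k Q H H)); last by slin.
    rewrite [RHS]tlift_tassoc; try by move=> ?; slin.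
    rewrite tlift_tmap; try by move=> ?; slin.
    apply: eq_tlift => v h; rewrite qcoactE /= [LHS]tliftE; last by sbal.
    by rewrite tlift_tmap //; move=> ?; slin.
  rewrite (coact_comodule V).1.
  rewrite [LHS]tlift_tmap; try by move=> ?; slin.
  by rewrite [RHS]tlift_tmap; try by move=> ?; slin.
rewrite tlift_tmap; try by move=> ?; slin.
rewrite -[in RHS]((coact_comodule V).2 (repr q)) (linear_tlift (L := pi)) //.
by apply: eq_tlift => v h; rewrite (linZ pi_lin).
Qed.

Let coact_act a q : qcoact (qact a q) =
  tmul (fun a q => qact a q) (@kmul k H) (acoact A a) (qcoact q).
Proof.
rewrite -[q]qpiK qactE !qcoactE coact_act.
rewrite [LHS]tlift_tmul; try by move=> ?; slin.
apply: eq_tlift => a0 a1.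
rewrite tlift_tmap; try by move=> ?; slin.
by apply: eq_tlift => v0 v1; rewrite qactE.
Qed.

Definition quot_rhm : relHopfMod A :=
  RelHopfMod act_linear act1 actM coact_comodule coact_act.

Fact qpi_ahom_subproof : (pi : V -> quot_rhm) \in ahom_pred V quot_rhm.
Proof.
apply/asboolP; split=> [u v|a v]; first exact: qpiD.
exact/esym/qactE.
Qed.
Definition qpi_ahom : ahom V quot_rhm := AHom qpi_ahom_subproof.

End QuotientHopfModule.

(** * Equivalences of categories *)

Section CategoryTheory.

Definition faithful (C D : category) (F : functor C D) : Prop :=
  forall (X Y : C) (f g : hom X Y), fmap F f = fmap F g -> f = g.
Definition full (C D : category) (F : functor C D) : Prop :=
  forall (X Y : C) (h : hom (F X) (F Y)), exists f : hom X Y, fmap F f = h.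

Lemma functor_iso_sym (C D : category) (F G : functor C D) :
  functor_iso F G -> functor_iso G F.
Proof.
case=> phi [psi [phiN phiK psiK]]; exists psi, phi; split=> // X Y f.
rewrite -[LHS]comp_idr -(phiK X) -comp_assoc (comp_assoc (fmap G f)) -phiN.
by rewrite -comp_assoc comp_assoc psiK comp_idl.
Qed.

Lemma functor_iso_trans (C D : category) (F G K : functor C D) :
  functor_iso F G -> functor_iso G K -> functor_iso F K.
Proof.
case=> phi [psi [phiN phiK psiK]] [phi' [psi' [phiN' phiK' psiK']]].
exists (fun X => comp (phi' X) (phi X)), (fun X => comp (psi X) (psi' X)).
split=> [X Y f|X|X].
- by rewrite -comp_assoc phiN comp_assoc phiN' comp_assoc.
- by rewrite -comp_assoc (comp_assoc (phi X)) phiK comp_idl phiK'.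
- by rewrite -comp_assoc (comp_assoc (psi' X)) psiK' comp_idl psiK.
Qed.

Lemma functor_iso_comp_l (C D E : category) (F G : functor C D) (K : functor E C) :
  functor_iso F G -> functor_iso (functor_comp F K) (functor_comp G K).
Proof.
case=> phi [psi [phiN phiK psiK]].
exists (fun X => phi (K X)), (fun X => psi (K X)).
by split=> [X Y f|X|X] /=; rewrite ?phiN ?phiK ?psiK.
Qed.

Lemma equivalence_faithful (C D : category) (T : functor C D) (U : functor D C) :
  functor_iso (functor_comp U T) (functor_id C) -> faithful T.
Proof.
case=> phi [psi [phiN phiK _]] X Y f g fg.
rewrite -[f]comp_idr -[g]comp_idr -(phiK X) !comp_assoc.
by have := (phiN _ _ f, phiN _ _ g) => /= -[<- <-]; rewrite fg.
Qed.

(** A preimage of h is phi o U(h) o psi: it has the same image as h under U T,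
    hence T maps it to h because U is faithful. *)
Lemma equivalence_full (C D : category) (T : functor C D) (U : functor D C) :
  functor_iso (functor_comp U T) (functor_id C) -> faithful U -> full T.
Proof.
case=> phi [psi [phiN phiK psiK]] fU X Y h.
exists (comp (phi Y) (comp (fmap U h) (psi X))); apply: fU.
rewrite -[LHS]comp_idl -(psiK Y) -comp_assoc.
have /= -> := phiN _ _ (comp (phi Y) (comp (fmap U h) (psi X))).
by rewrite !comp_assoc psiK comp_idl -comp_assoc psiK comp_idr.
Qed.

Lemma functor_iso_cancel (C D E : category) (T : functor D E) (F G : functor C D) :
  faithful T -> full T -> functor_iso (functor_comp T F) (functor_comp T G) ->
  functor_iso F G.
Proof.
move=> fT uT [phi [psi [phiN phiK psiK]]].
pose a X := sval (cid (uT _ _ (phi X))); pose b X := sval (cid (uT _ _ (psi X))).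
have aE X : fmap T (a X) = phi X by rewrite /a; case: cid.
have bE X : fmap T (b X) = psi X by rewrite /b; case: cid.
exists a, b; split=> [X Y f|X|X]; apply: fT; rewrite ?fmap_comp ?aE ?bE ?fmap_id.
- exact: phiN.
- exact: phiK.
- exact: psiK.
Qed.
End CategoryTheory.

(** * The trace ideal of an object sent to the regular module *)

Section Colinear.
Variables (k : comPzRingType) (H : hopfAlg k) (A : comodAlg H).
Variables (V W : relHopfMod A).

Lemma colinear_HOM (f : ahom V W) :
  (forall v, coact W (f v) = tmap f idfun (coact V v)) -> f \in HOM_pred V W.
Proof.
move=> fco; apply/asboolP; exists (f ⊗ (1 : H)); apply/HOM_coact_eqP => v.
rewrite fco; apply: eq_tlift => v0 v1.
by rewrite tliftE ?mulr1 //; sbal.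
Qed.
End Colinear.

Section Trace.
Variables (k : comPzRingType) (H : hopfAlg k) (A B : comodAlg H).
Hypothesis H_projective : projective H.

Section TraceIdeal.
Variable N : relHopfMod B.
Local Notation R := (reg_rhm B).

Definition trace_pred : {pred R} := [pred b | `[< exists s : seq (HOM N R * N),
  b = \sum_(q <- s) q.1 q.2 >]].

Lemma trace_ev (g : HOM N R) n : g n \in trace_pred.
Proof. by apply/asboolP; exists [:: (g, n)]; rewrite big_seq1. Qed.

Lemma trace_closed : submod_closed trace_pred.
Proof.
split=> [|c u v /asboolP[s ->] /asboolP[t ->]].
  by apply/asboolP; exists [::]; rewrite big_nil.
apply/asboolP; exists ([seq (q.1, c *: q.2) | q <- s] ++ t).
rewrite big_cat big_map scaler_sumr; congr (_ + _).
by apply: eq_bigr => q _; rewrite linearZ.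
Qed.

Lemma trace_act b v : v \in trace_pred -> act R b v \in trace_pred.
Proof.
move=> /asboolP[s ->]; apply/asboolP; exists [seq (q.1, act N b q.2) | q <- s].
rewrite big_map linear_sum; apply: eq_bigr => q _ /=.
exact/esym/(ahomP q.1).2.
Qed.

(** For g in HOM one has rho(g(n)) = g_[0](n_[0]) ⊗ n_[1] g_[1] with g_[0]
    again in HOM, so the first factor stays in the trace. *)
Lemma trace_coact v : v \in trace_pred ->
  tmap (qpi trace_closed) idfun (coact R v) = 0.
Proof.
have pi_lin := qpi_linear trace_closed.
have Lpi := tmap_linear pi_lin (@lin_id _ H).
move=> /asboolP[s ->]; rewrite linear_sum (linsum Lpi) big1 // => -[g n] _ /=.
rewrite -[LHS]/(tlift (fun (w : R) (h : H) => qpi trace_closed w ⊗ h)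
  (coact R (g n))) (sw_HOM_coact H_projective); try by move=> ?; slin.
rewrite [LHS]big1 // => -[n0 n1] _;
  rewrite [LHS]big1 // => -[g' h] _ /=.
have /qpi_eq0 -> := trace_ev g' n0.
exact: lin0 (tpure_lin_l _ _ _).
Qed.
End TraceIdeal.

Variable U : functor (HOMcat B) (HOMcat A).
Hypotheses (U_colinear : colinear_functor U) (U_faithful : faithful U)
  (U_full : full U).

(** Let pi be the projection of B onto its quotient by the trace I of N in B.
    It kills every g in HOM(N, B), so U(pi) kills every U(g). Since U is full
    and A is a retract of U(N), every map a |-> a x from A to U(B), precomposed
    with j, is such a U(g). Hence U(pi) = 0, and pi = 0 because U is faithful;
    that is, 1 lies in I. *)
Lemma trace_full (N : relHopfMod B) (i : HOM (reg_rhm A) (U N))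
    (j : HOM (U N) (reg_rhm A)) : HOM_comp j i = HOM_id _ ->
  exists s : seq (HOM N (reg_rhm B) * N), \sum_(q <- s) q.1 q.2 = 1.
Proof.
move=> ji.
pose Q := quot_rhm (@trace_act N) (@trace_coact N).
pose pia := qpi_ahom (@trace_act N) (@trace_coact N).
have piH : pia \in HOM_pred (reg_rhm B) Q.
  by apply: colinear_HOM => v; exact: qcoactE.
pose pi : HOM (reg_rhm B) Q := Hom piH.
suff pi0 : pi = 0.
  have /qpi_eq0 : pi 1 = 0 by rewrite pi0.
  by case/asboolP=> s ->; exists s.
have LU V W := fun_map_linear U_colinear (V := V) (W := W).
apply: U_faithful; rewrite -[RHS]/(fun_map U 0) (lin0 (LU _ _)).
rewrite -[LHS]/(fun_map U pi); apply: HOM_eqP => x.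
have [g gE] := U_full (HOM_comp (orbit x) j : hom (U N) (U (reg_rhm B))).
have pg : HOM_comp pi g = 0.
  by apply: HOM_eqP => n; apply/qpi_eq0/trace_ev.
have ji1 : j (i (1 : A)) = (1 : A).
  exact: (congr1 (fun f : HOM (reg_rhm A) (reg_rhm A) => f (1 : A)) ji).
transitivity (fun_map U (HOM_comp pi g) (i (1 : A))); last first.
  by rewrite pg (lin0 (LU _ _)).
rewrite fun_map_comp [fun_map U g]gE /= ji1.
by congr (fun_map _ _ _); exact/esym/orbit1.
Qed.
End Trace.

(** * The dual of a bimodule with a dual basis *)

Section DualCoaction.
Variables (k : comPzRingType) (H : hopfAlg k) (A B : comodAlg H).
Variable N : bimod B A.
Local Notation R := (reg_rhm B).
Local Notation M := (ahom N R).
Variable s : seq (M * N).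
Hypothesis s_dual : forall n : N, n = \sum_(q <- s) act N (q.1 n : B) q.2.
Hypothesis dual_HOM : forall f : M, f \in HOM_pred N R.

Fact dual_act_subproof (a : A) (f : M) :
  (fun n : N => f (ract N a n)) \in ahom_pred N R.
Proof.
apply/asboolP; split=> [u v|b v]; first by rewrite !linearD.
by rewrite -act_ract (ahomP f).2.
Qed.
Lemma dual_act_linear (a : A) :
  linear (fun f : M => AHom (dual_act_subproof a f)).
Proof.
move=> c f g; apply: ahom_eqP => n; rewrite [RHS]ev_linear.
exact: (ev_linear (ract N a n)).
Qed.
Definition dual_act (a : A) : {linear M -> M} := mklin (dual_act_linear a).

Fact dual_ract_subproof (b : B) (f : M) :
  (fun n : N => rmul b (f n : B)) \in ahom_pred N R.
Proof.
apply/asboolP; split=> [u v|c v]; first by rewrite !linearD.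
by rewrite (ahomP f).2; exact/esym/mulrA.
Qed.
Lemma dual_ract_linear (b : B) :
  linear (fun f : M => AHom (dual_ract_subproof b f)).
Proof.
move=> c f g; apply: ahom_eqP => n; rewrite [RHS]ev_linear.
by rewrite -[LHS]/(rmul b ((c *: f + g) n : B)) ev_linear linearP.
Qed.
Definition dual_ract (b : B) : {linear M -> M} := mklin (dual_ract_linear b).

Lemma dual_ract_linear_l (f : M) : linear (dual_ract^~ f).
Proof.
move=> c b b'; apply: ahom_eqP => n; rewrite [RHS]ev_linear.
exact: (lin_mul_r (f n : B) (@lin_id _ B)).
Qed.

Lemma dual_act_linear_l (f : M) : linear (dual_act^~ f).
Proof.
move=> c a b; apply: ahom_eqP => n; rewrite [RHS]ev_linear.
by rewrite -[LHS]/(f (ract N (c *: a + b) n)) (ract_linear n) linearP.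
Qed.

Lemma dual_expand (f : M) : f = \sum_(q <- s) dual_ract (f q.2) q.1.
Proof.
apply: ahom_eqP => n; rewrite [in LHS](s_dual n) linear_sum.
rewrite (linsum (@ev_linear _ _ _ N R n)).
by apply: eq_bigr => q _; exact: (ahomP f).2.
Qed.

(** With a dual basis, Hom_B(N, B) ⊗ Z embeds into the maps from N to B ⊗ Z,
    so every identity about the coaction of the dual can be checked by
    evaluation at elements of N. *)
Lemma dual_tens_inj (Z : lmodType k) (x y : (M ⊗ Z)%type) :
  (forall n, tmap (fun f : M => f n) (@idfun Z) x =
             tmap (fun f : M => f n) idfun y) ->
  x = y.
Proof.
have expand (z : (M ⊗ Z)%type) : z = \sum_(q <- s)
    tlift (fun (b : B) (w : Z) => dual_ract b q.1 ⊗ w)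
      (tmap (fun f : M => f q.2 : B) idfun z).
  transitivity (tlift (fun (f : M) w =>
    \sum_(q <- s) (dual_ract (f q.2) q.1 ⊗ w)) z).
    rewrite -[LHS]tlift_pure; apply: eq_tlift => f w.
    by rewrite {1}(dual_expand f) (linsum (tpure_lin_l _ _ w)).
  have L q := dual_ract_linear_l q.
  rewrite [LHS]exchange_big; apply: eq_bigr => q _.
  by rewrite tlift_tmap // => ?; slin.
by move=> xy; rewrite (expand x) (expand y); apply: eq_bigr => q _; rewrite xy.
Qed.

Lemma dual_coact_inj (f : M) (x y : (M ⊗ H)%type) :
  HOM_coact_eq f x -> HOM_coact_eq f y -> x = y.
Proof. by move=> fx fy; apply: dual_tens_inj => n; rewrite fx fy. Qed.

(** The element f_[0] ⊗ f_[1], which is unique by [dual_coact_inj]; linearity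
    and the comodule axioms all follow from this uniqueness. *)
Definition dual_coact_fun (f : M) : (M ⊗ H)%type :=
  sval (cid (HOMP (Hom (dual_HOM f)))).

Lemma dual_coactP (f : M) : HOM_coact_eq f (dual_coact_fun f).
Proof. exact: svalP (cid (HOMP (Hom (dual_HOM f)))). Qed.

Lemma dual_coact_eq (f : M) (x : (M ⊗ H)%type) :
  HOM_coact_eq f x -> dual_coact_fun f = x.
Proof. exact: dual_coact_inj (dual_coactP f). Qed.

Lemma dual_coact_linear : linear dual_coact_fun.
Proof.
move=> c f g; apply: dual_coact_eq => n.
have L : linear (tmap (fun g : M => g n) (@idfun H)).
  by apply: tmap_linear; slin.
rewrite L !dual_coactP; symmetry; apply: tlift_lin => n0 n1.
rewrite [X in coact R X](ev_linear n0) linearP.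
have : linear (tmap (N := H) (N' := H) (@idfun R) (kmul (antipV H n1))) by slin.
exact.
Qed.
Definition dual_coact : {linear M -> (M ⊗ H)%type} := mklin dual_coact_linear.

Lemma sw_dual (P : lmodType k) (F : R -> H -> P) (f : M) n :
  (forall h, linear (F^~ h)) -> (forall w, linear (F w)) ->
  tlift F (coact R (f n)) =
  tlift (fun n0 (n1 : H) => tlift (fun (g : M) (h : H) => F (g n0) (n1 * h : H))
    (dual_coact f)) (coact N n).
Proof. exact: (sw_HOM _ (dual_coactP f)). Qed.

(** Both sides are determined by their values at n in N. There
    [sw_HOM_assoc], with f_[0](m)_[0] ⊗ f_[0](m)_[1] expanded in terms of the
    coaction of f_[0], is the wanted identity up to a factor n_[1], which is
    removed by untwisting. The tensor factor that carries n_[1] has to be the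
    last one; this is why the two factors H are swapped. *)
Lemma dual_coact_coassoc (f : M) :
  tassoc (tmap dual_coact idfun (dual_coact f)) =
  tmap idfun (comul H) (dual_coact f).
Proof.
pose phi (n : N) := tlift (fun (g : M) (h : H) => tlift (fun (g' : M) (h' : H) =>
  ((g' n : R) ⊗ h) ⊗ h') (dual_coact g)) (dual_coact f).
pose psi (n : N) := tlift (fun (g : M) (h : H) => tlift (fun (h1 h2 : H) =>
  ((g n : R) ⊗ h2) ⊗ h1) (comul H h)) (dual_coact f).
pose swap (t : ((R ⊗ H) ⊗ H)%type) : ((R ⊗ H) ⊗ H)%type :=
  tlift (fun u h => tlift (fun b h' => (b ⊗ h) ⊗ h') u) t.
have swap_lin : linear swap by rewrite /swap; slin.
have swapE b h h' : swap ((b ⊗ h) ⊗ h') = (b ⊗ h') ⊗ h.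
  by rewrite /swap tliftE ?tliftE //; sbal.
suff E : phi =1 psi.
  apply: dual_tens_inj => n.
  transitivity (tassoc (swap (phi n))).
    rewrite [LHS]tlift_tassoc; try by move=> ?; slin.
    rewrite tlift_tmap; try by move=> ?; slin.
    rewrite /phi (linear_tlift (L := fun t => tassoc (swap t))); last first.
      by apply: (lin_comp (f := @tassoc k R H H)) swap_lin; slin.
    apply: eq_tlift => g h.
    rewrite (linear_tlift (L := fun t => tassoc (swap t))); last first.
      by apply: (lin_comp (f := @tassoc k R H H)) swap_lin; slin.
    apply: eq_tlift => g' h'.
    by rewrite swapE /tassoc tliftE ?tliftE //; sbal.
  rewrite E /psi.
  rewrite [RHS]tlift_tmap; try by move=> ?; slin.
  rewrite (linear_tlift (L := fun t => tassoc (swap t))); last first.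
    by apply: (lin_comp (f := @tassoc k R H H)) swap_lin; slin.
  apply: eq_tlift => g h.
  rewrite (linear_tlift (L := fun t => tassoc (swap t))); last first.
    by apply: (lin_comp (f := @tassoc k R H H)) swap_lin; slin.
  rewrite -[in RHS](tlift_pure (comul H h)).
  rewrite (linear_tlift (L := fun t => _ ⊗ t)); last by slin.
  apply: eq_tlift => h1 h2.
  by rewrite swapE /tassoc tliftE ?tliftE //; sbal.
apply: (twist_inj (coact_comodule N)); rewrite /phi /psi; [slin | slin |] => n.
have := congr1 swap (sw_HOM_assoc n (dual_coactP f)).
rewrite !(linear_tlift (L := swap)) // => E.
transitivity (tlift (fun (g : M) (h : H) => swap (coact R (g n) ⊗ h)) (dual_coact f)).
  transitivity (tlift (fun (g : M) (h : H) => tlift (fun n0 (n1 : H) =>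
    tlift (fun (g' : M) (h' : H) =>
      ((g' n0 : R) ⊗ h) ⊗ (n1 * h' : H)) (dual_coact g))
    (coact N n)) (dual_coact f)).
    rewrite [RHS]exchange_tlift; apply: eq_tlift => n0 n1.
    rewrite [LHS](linear_tlift (L := tmap _ _)); last by slin.
    apply: eq_tlift => g h.
    rewrite [LHS](linear_tlift (L := tmap _ _)); last by slin.
    apply: eq_tlift => g' h'.
    by rewrite tmapE //; slin.
  apply: eq_tlift => g h; rewrite /swap tliftE; last by sbal.
  by rewrite sw_dual //; move=> ?; slin.
rewrite [LHS]E.
transitivity (tlift (fun (g : M) (h : H) => tlift (fun h1 h2 : H =>
  tlift (fun n0 (n1 : H) =>
    ((g n0 : R) ⊗ h2) ⊗ (n1 * h1 : H)) (coact N n)) (comul H h)) (dual_coact f)).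
  apply: eq_tlift => g h; rewrite (linear_tlift (L := swap)) //.
  apply: eq_tlift => h1 h2; rewrite (linear_tlift (L := swap)) //.
  by apply: eq_tlift => n0 n1; rewrite swapE.
transitivity (tlift (fun n0 (n1 : H) => tlift (fun (g : M) (h : H) =>
  tlift (fun h1 h2 : H =>
    ((g n0 : R) ⊗ h2) ⊗ (n1 * h1 : H)) (comul H h)) (dual_coact f)) (coact N n)).
  rewrite [RHS]exchange_tlift; apply: eq_tlift => g h.
  by rewrite [RHS]exchange_tlift.
apply: eq_tlift => n0 n1.
rewrite [RHS](linear_tlift (L := tmap _ _)); last by slin.
apply: eq_tlift => g h.
rewrite [RHS](linear_tlift (L := tmap _ _)); last by slin.
apply: eq_tlift => h1 h2.
by rewrite tmapE //; slin.
Qed.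

Lemma dual_coact_comodule : is_comodule dual_coact.
Proof.
split=> f; first exact: dual_coact_coassoc.
apply: ahom_eqP => n.
rewrite (linear_tlift (L := fun g : M => g n)); last exact: ev_linear.
rewrite -[RHS]((acoact_comodule B).2 (f n)).
rewrite (sw_dual (F := fun (b : B) h => counit H h *: b)); try by move=> ?; slin.
rewrite [RHS]exchange_tlift; apply: eq_tlift => g h.
rewrite (linZ (@ev_linear _ _ _ N R n)).
rewrite -(sw_counit (coact_comodule N) (F := fun n => counit H h *: g n));
  last by slin.
by apply: eq_tlift => n0 n1; rewrite counitM scalerA mulrC.
Qed.

Lemma dual_coact_act (a : A) (f : M) : dual_coact (dual_act a f) =
  tmul (fun a f => dual_act a f) (@kmul k H) (acoact A a) (dual_coact f).
Proof.
have La := dual_act_linear_l.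
apply/dual_coact_eq/HOM_coact_eqP => n.
have /HOM_coact_eqP fE := dual_coactP f.
rewrite [LHS](fE (ract N a n)) coact_ract.
rewrite tlift_tmul; try by move=> ?; slin.
apply: eq_tlift => n0 n1.
rewrite tlift_tmul; try by move=> ?; slin.
apply: eq_tlift => a0 a1; apply: eq_tlift => g h.
by rewrite /kmul mulrA.
Qed.

Lemma dual_coact_ract (b : B) (f : M) : dual_coact (dual_ract b f) =
  tmul (fun f b => dual_ract b f) (@kmul k H) (dual_coact f) (acoact B b).
Proof.
have Lb := dual_ract_linear_l.
apply/dual_coact_eq/HOM_coact_eqP => n.
rewrite [LHS](acoactM (f n : B) b).
rewrite [LHS](sw_dual (F := fun (c : R) (h : H) => tlift
  (fun (b0 : B) (b1 : H) => (kmul (c : B) b0 : R) ⊗ (h * b1 : H)) (acoact B b))); last 2 first.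
- by move=> h; slin.
- by move=> c; slin.
apply: eq_tlift => n0 n1.
rewrite tlift_tmul; try by move=> ?; slin.
apply: eq_tlift => g h; apply: eq_tlift => b0 b1.
by rewrite /kmul mulrA.
Qed.

Let dual_act1 (f : M) : dual_act 1 f = f.
Proof. by apply: ahom_eqP => n; rewrite /= ract1. Qed.
Let dual_actM (a b : A) (f : M) :
  dual_act (a * b) f = dual_act a (dual_act b f).
Proof. by apply: ahom_eqP => n; rewrite /= ractM. Qed.

Definition dual_rhm : relHopfMod A :=
  @RelHopfMod k H A M dual_act dual_coact dual_act_linear_l dual_act1 dual_actM
    dual_coact_comodule dual_coact_act.

Let dual_ract1 (f : M) : dual_ract 1 f = f.
Proof. by apply: ahom_eqP => n; exact: mulr1. Qed.
Let dual_ractM (b c : B) (f : M) :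
  dual_ract (b * c) f = dual_ract c (dual_ract b f).
Proof. by apply: ahom_eqP => n; exact: mulrA. Qed.
Let dual_act_ract (a : A) (b : B) (f : M) :
  dual_act a (dual_ract b f) = dual_ract b (dual_act a f).
Proof. exact: ahom_eqP. Qed.

Definition dual_bimod : bimod A B :=
  @Bimod k H A B dual_rhm dual_ract dual_ract_linear_l dual_ract1 dual_ractM
    dual_act_ract dual_coact_ract.
End DualCoaction.

(** * The Morita context of a progenerator *)

(** Classical Morita theory for a bimodule N that is finitely generated
    projective over B (dual basis s), generates B-modules (1 is in the trace,
    by t) and has A as its ring of B-endomorphisms acting from the right. Every
    identity in A is checked on N, where alpha(f ⊗ n) acts as
    n' |-> f(n') n. *)
Section MoritaContext.
Variables (k : comPzRingType) (H : hopfAlg k) (A B : comodAlg H).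
Variable N : bimod B A.
Local Notation R := (reg_rhm B).
Variables s t : seq (ahom N R * N).
Hypothesis s_dual : forall n : N, n = \sum_(q <- s) act N (q.1 n : B) q.2.
Hypothesis t_trace : \sum_(q <- t) q.1 q.2 = (1 : B).
Hypothesis dual_HOM : forall f : ahom N R, f \in HOM_pred N R.
Hypothesis ract_onto :
  forall f : ahom N N, exists a, forall n, f n = ract N a n.
Hypothesis ract_faithful : forall a, (forall n, ract N a n = 0) -> a = 0.
Local Notation M := (dual_bimod s_dual dual_HOM).
Local Notation MN := (btens_bimod M N).
Local Notation NM := (btens_bimod N M).
Local Notation pMN := (tpure (ract M) (act N)).
Local Notation pNM := (tpure (ract N) (act M)).

Lemma ract_inj (a a' : A) : (forall n, ract N a n = ract N a' n) -> a = a'.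
Proof.
move=> aa'; apply/eqP; rewrite -subr_eq0; apply/eqP/ract_faithful => n.
by rewrite addrC -scaleN1r (ract_linear n) aa' scaleN1r addNr.
Qed.

Fact rank_one_subproof (f : M) (n : N) :
  (fun n' : N => act N (f n' : B) n) \in ahom_pred N N.
Proof.
apply/asboolP; split=> [u v|b v].
  by rewrite (linD (@linearP _ _ _ _ f)) (linD (act_linear n)).
by rewrite (ahomP f).2 -actM.
Qed.

Definition pair_alpha (f : M) (n : N) : A :=
  sval (cid (ract_onto (AHom (rank_one_subproof f n)))).

Lemma pair_alphaE f n n' : ract N (pair_alpha f n) n' = act N (f n' : B) n.
Proof. by rewrite /pair_alpha; case: cid => a /= ->. Qed.

Lemma pair_alpha_balanced : balanced (ract M) (act N) pair_alpha.
Proof.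
split=> [n c f g|f c n m|b f n]; apply: ract_inj => n'.
- rewrite (ract_linear n') !pair_alphaE.
  by rewrite -(act_linear n); congr (act N _ n); exact: ev_linear.
- by rewrite (ract_linear n') !pair_alphaE linearP.
by rewrite !pair_alphaE -actM.
Qed.

Definition alpha_fun : MN -> reg_bimod A := tlift pair_alpha.
Lemma alphaE f n : alpha_fun (pMN f n) = pair_alpha f n.
Proof. exact: tliftE pair_alpha_balanced. Qed.
Lemma alpha_linear : linear alpha_fun.
Proof. exact: tlift_linear pair_alpha_balanced. Qed.

Lemma pair_beta_balanced :
  balanced (ract N) (act M) (fun n f => (f n : B)).
Proof.
by split=> [f|n|a n f]; [exact: (linearP (f : ahom N R)) | exact: (ev_linear n) |].
Qed.

Definition beta_fun : NM -> reg_bimod B := tlift (fun n (f : M) => (f n : B)).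
Lemma betaE n f : beta_fun (pNM n f) = f n.
Proof. exact: tliftE pair_beta_balanced. Qed.
Lemma beta_linear : linear beta_fun.
Proof. exact: tlift_linear pair_beta_balanced. Qed.

Lemma alpha_act a x : alpha_fun (act MN a x) = act (reg_bimod A) a (alpha_fun x).
Proof.
have La := alpha_linear.
apply: (tens_ext (L := fun x => alpha_fun (act MN a x))
  (L' := fun x => act (reg_bimod A) a (alpha_fun x))); [slin | slin |].
move=> f n; rewrite /= btens_actE !alphaE; apply: ract_inj => n'.
by rewrite ractM !pair_alphaE.
Qed.

Lemma alpha_ract a x :
  alpha_fun (ract MN a x) = ract (reg_bimod A) a (alpha_fun x).
Proof.
have La := alpha_linear.
apply: (tens_ext (L := fun x => alpha_fun (ract MN a x))
  (L' := fun x => ract (reg_bimod A) a (alpha_fun x))); [slin | slin |].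
move=> f n; rewrite /= btens_ractE !alphaE; apply: ract_inj => n'.
by rewrite ractM !pair_alphaE act_ract.
Qed.

(** Elements of A are recovered from their action through
    a = \sum_i alpha(f_i ⊗ n_i a), a linear expression in the n_i a; so
    faithfulness of the action persists after tensoring with H. *)
Lemma ract_tens_inj (y y' : (A ⊗ H)%type) :
  (forall n, tmap (fun a : A => ract N a n) (@idfun H) y =
             tmap (fun a : A => ract N a n) idfun y') -> y = y'.
Proof.
have La f : linear (pair_alpha f) by case: pair_alpha_balanced => _ L _; exact: L.
have alpha_expand a : a = \sum_(q <- s) pair_alpha q.1 (ract N a q.2).
  apply: ract_inj => n; rewrite [in LHS](s_dual n) linear_sum.
  rewrite [RHS](linsum (ract_linear n)); apply: eq_bigr => q _.
  by rewrite pair_alphaE act_ract.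
have expand (z : (A ⊗ H)%type) : z = \sum_(q <- s)
    tlift (fun (n : N) (h : H) => pair_alpha q.1 n ⊗ h)
      (tmap (fun a : A => ract N a q.2) idfun z).
  transitivity (tlift (fun a (h : H) =>
      \sum_(q <- s) (pair_alpha q.1 (ract N a q.2) ⊗ h)) z).
    rewrite -[LHS]tlift_pure; apply: eq_tlift => a h.
    by rewrite {1}(alpha_expand a) (linsum (tpure_lin_l _ _ h)).
  rewrite [LHS]exchange_big; apply: eq_bigr => q _.
  by rewrite tlift_tmap // => ?; slin.
by move=> yy'; rewrite (expand y) (expand y'); apply: eq_bigr => q _; rewrite yy'.
Qed.

(** It suffices to compare the actions on n' in N, after twisting in n'. Then
    both sides are rho(n' alpha(f ⊗ n)) = rho(f(n') n). *)
Lemma alpha_colinear : colinear (coact MN) (coact (reg_bimod A)) alpha_fun.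
Proof.
have La := alpha_linear; split=> // x.
apply: (tens_ext (L := fun x => coact (reg_bimod A) (alpha_fun x))
  (L' := fun x => tmap alpha_fun idfun (coact MN x))); [slin | slin |].
move=> f n; rewrite alphaE; apply: ract_tens_inj.
apply: (twist_inj (coact_comodule N)); [slin | slin |] => n'.
transitivity (coact N (ract N (pair_alpha f n) n')).
  rewrite coact_ract; apply: eq_tlift => n0 n1.
  rewrite [LHS]tlift_tmap; try by move=> ?; slin.
  by apply: eq_tlift.
rewrite pair_alphaE coact_act.
rewrite [LHS](sw_dual s_dual dual_HOM (F := fun (c : R) (h : H) =>
  tlift (fun (m0 : N) (m1 : H) => act N (c : B) m0 ⊗ (h * m1 : H)) (coact N n)));
  last 2 first.
- by move=> h; slin.
- by move=> c; slin.
apply: eq_tlift => n0 n1.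
rewrite /= btens_coactE.
rewrite [RHS]tlift_tmap; try by move=> ?; slin.
rewrite [RHS]tlift_tmap; try by move=> ?; slin.
rewrite [RHS]tlift_tmul; try by move=> ?; slin.
apply: eq_tlift => g h; apply: eq_tlift => m0 m1.
by rewrite alphaE pair_alphaE /kmul mulrA.
Qed.

Definition alpha : bimod_hom MN (reg_bimod A) :=
  BimodHom alpha_act alpha_ract alpha_colinear.

Lemma beta_act b x : beta_fun (act NM b x) = act (reg_bimod B) b (beta_fun x).
Proof.
have Lb := beta_linear.
apply: (tens_ext (L := fun x => beta_fun (act NM b x))
  (L' := fun x => act (reg_bimod B) b (beta_fun x))); [slin | slin |].
by move=> n f; rewrite /= btens_actE !betaE (ahomP f).2.
Qed.

Lemma beta_ract b x :
  beta_fun (ract NM b x) = ract (reg_bimod B) b (beta_fun x).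
Proof.
have Lb := beta_linear.
apply: (tens_ext (L := fun x => beta_fun (ract NM b x))
  (L' := fun x => ract (reg_bimod B) b (beta_fun x))); [slin | slin |].
move=> n f; transitivity (beta_fun (pNM n (ract M b f))).
  by congr beta_fun; exact: btens_ractE.
by rewrite !betaE.
Qed.

Lemma beta_colinear : colinear (coact NM) (coact (reg_bimod B)) beta_fun.
Proof.
have Lb := beta_linear; split=> // x.
apply: (tens_ext (L := fun x => coact (reg_bimod B) (beta_fun x))
  (L' := fun x => tmap beta_fun idfun (coact NM x))); [slin | slin |].
move=> n f; rewrite betaE.
rewrite [RHS](_ : _ = tmap beta_fun idfun (tmul (pNM : N -> M -> NM) (@kmul k H)
  (coact N n) (coact M f))); last by congr (tmap _ _ _); exact: btens_coactE.
rewrite [RHS]tlift_tmul; try by move=> ?; slin.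
rewrite -[LHS]tlift_pure.
rewrite [LHS](sw_dual s_dual dual_HOM); try by move=> ?; slin.
apply: eq_tlift => n0 n1; apply: eq_tlift => g h.
by rewrite betaE.
Qed.

Definition beta : bimod_hom NM (reg_bimod B) :=
  BimodHom beta_act beta_ract beta_colinear.

Lemma alpha_betaP (f : M) (n : N) (f' : M) :
  act M (alpha (pMN f n)) f' = ract M (beta (pNM n f')) f.
Proof.
apply: ahom_eqP => n'; rewrite /= alphaE betaE pair_alphaE.
exact: (ahomP f').2.
Qed.

Lemma beta_alphaP (n : N) (f : M) (n' : N) :
  act N (beta (pNM n f)) n' = ract N (alpha (pMN f n')) n.
Proof. by rewrite /= alphaE betaE pair_alphaE. Qed.

Definition morita : morita_context A B := MoritaContext alpha_betaP beta_alphaP.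

Lemma alpha_bij : bijective alpha_fun.
Proof.
have La := alpha_linear.
exists (fun a => \sum_(q <- s) pMN q.1 (ract N a q.2)); last first.
  move=> a; rewrite (linsum La); apply: ract_inj => n.
  rewrite [in RHS](s_dual n) linear_sum.
  rewrite [LHS](linsum (ract_linear n)); apply: eq_bigr => q _.
  by rewrite alphaE pair_alphaE act_ract.
have L q : linear (fun x => pMN q.1 (ract N (alpha_fun x) q.2)) by slin.
apply: (tens_ext (L := fun x => \sum_(q <- s) pMN q.1 (ract N (alpha_fun x) q.2))
  (L' := id)) => //.
  move=> c x y; rewrite scaler_sumr -big_split.
  by apply: eq_bigr => q _; exact: L.
move=> f n; transitivity (pMN (\sum_(q <- s) ract M (f q.2) q.1) n).
  rewrite (linsum (tpure_lin_l _ _ n)); apply: eq_bigr => q _.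
  by rewrite alphaE pair_alphaE tpure_bal.
by congr (pMN _ n); exact/esym/(dual_expand s_dual f).
Qed.

Lemma beta_bij : bijective beta_fun.
Proof.
have Lb := beta_linear.
exists (fun b => \sum_(q <- t) pNM (act N b q.2) q.1); last first.
  move=> b; rewrite (linsum Lb) -[RHS](mulr1 b) -t_trace mulr_sumr.
  by apply: eq_bigr => q _; rewrite betaE (ahomP q.1).2.
have L q : linear (fun x => pNM (act N (beta_fun x) q.2) q.1) by slin.
apply: (tens_ext (L := fun x => \sum_(q <- t) pNM (act N (beta_fun x) q.2) q.1)
  (L' := id)) => //.
  move=> c x y; rewrite scaler_sumr -big_split.
  by apply: eq_bigr => q _; exact: L.
move=> n f; transitivity (pNM n (\sum_(q <- t) ract M (q.1 q.2) f)).
  rewrite (linsum (tpure_lin_r _ _ n)); apply: eq_bigr => q _.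
  rewrite betaE -pair_alphaE tpure_bal; congr (pNM n _).
  apply: ahom_eqP => n'; rewrite /= pair_alphaE.
  exact: (ahomP q.1).2.
congr (pNM n _); rewrite -(linsum (ract_linear f)) t_trace.
by apply: ahom_eqP => n'; exact: mulr1.
Qed.

Lemma morita_strict : strict morita.
Proof. by split; [exact: alpha_bij | exact: beta_bij]. Qed.
End MoritaContext.

(** * Colinear bijections and natural isomorphisms *)

Section IsoOfBijections.
Variables (k : comPzRingType) (H : hopfAlg k) (A : comodAlg H).

Lemma colinear_bij_invertible (V W : relHopfMod A) (f : HOM V W) :
  (forall v, coact W (f v) = tmap f idfun (coact V v)) -> bijective f ->
  exists g : HOM W V, HOM_comp f g = HOM_id W /\ HOM_comp g f = HOM_id V.
Proof.
move=> fco [g fK gK].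
have gP : g \in ahom_pred W V.
  apply/asboolP; split=> [u v|a v]; apply: (can_inj fK).
    by rewrite (ahomP f).1 !gK.
  by rewrite (ahomP f).2 !gK.
have glin : linear (AHom gP) by exact: linearP.
have gco v : coact V (AHom gP v) = tmap (AHom gP) idfun (coact W v).
  rewrite -[in RHS](gK v) fco [RHS]tlift_tmap; try by move=> ?; slin.
  by rewrite -[LHS]tlift_pure; apply: eq_tlift => v0 v1; rewrite /= fK.
by exists (Hom (colinear_HOM gco)); split; apply: HOM_eqP.
Qed.
End IsoOfBijections.

Lemma functor_iso_of_invertible (C D : category) (F G : functor C D)
    (phi : forall X, hom (F X) (G X)) :
  (forall X Y (f : hom X Y), comp (phi Y) (fmap F f) = comp (fmap G f) (phi X)) ->
  (forall X, exists psi : hom (G X) (F X),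
     comp (phi X) psi = idm (G X) /\ comp psi (phi X) = idm (F X)) ->
  functor_iso F G.
Proof.
move=> phiN phi_inv; exists phi, (fun X => sval (cid (phi_inv X))).
by split=> // X; case: cid => psi [].
Qed.

(** * Fully faithful colinear functors are tensor functors *)

(** An Eilenberg-Watts argument in which full faithfulness takes the place of
    exactness and preservation of coproducts: for N = T(A), the map
    N ⊗_A V -> T(V), n ⊗ v |-> T(a |-> a v)(n), is bijective as soon as T is
    fully faithful and the trace of N in B contains 1. *)
Section EilenbergWatts.
Variables (k : comPzRingType) (H : hopfAlg k) (A B : comodAlg H).
Hypothesis H_projective : projective H.
Variable T : functor (HOMcat A) (HOMcat B).
Hypotheses (T_colinear : colinear_functor T) (T_faithful : faithful T)
  (T_full : full T).
Local Notation N := (fun_bimod T_colinear H_projective).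
Local Notation R := (reg_rhm B).
Variable t : seq (HOM N R * N).
Hypothesis t_trace : \sum_(q <- t) q.1 q.2 = (1 : B).

Section Eta.
Variable V : relHopfMod A.
Local Notation NV := (btens_rhm N V).
Local Notation pure := (tpure (ract N) (act V)).

Lemma eta_linear_r (n : N) : linear (fun v : V => fun_map T (orbit v) n).
Proof.
have L1 := fun_map_linear T_colinear (V := reg_rhm A) (W := V).
have L2 := @orbit_linear _ _ A V.
by slin.
Qed.

Lemma eta_balanced : balanced (ract N) (act V)
  (fun n v => fun_map T (orbit v) n).
Proof.
split=> [v|n|a n v]; [exact: linearP | exact: eta_linear_r |].
by rewrite -[LHS]fun_map_comp comp_orbit.
Qed.

Definition eta_fun : NV -> T V := tlift (fun n v => fun_map T (orbit v) n).
Lemma etaE n v : eta_fun (pure n v) = fun_map T (orbit v) n.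
Proof. exact: tliftE eta_balanced. Qed.
Lemma eta_linear : linear eta_fun.
Proof. exact: tlift_linear eta_balanced. Qed.

Fact eta_ahom_subproof : eta_fun \in ahom_pred NV (T V).
Proof.
have L := eta_linear; apply/asboolP; split=> [u v|b x]; first exact: (linD L).
apply: (tens_ext (L := fun x => eta_fun (act NV b x))
  (L' := fun x => act (T V) b (eta_fun x))); [slin | slin |].
by move=> n v; rewrite /= btens_actE !etaE (ahomP (fun_map T _)).2.
Qed.

Lemma eta_colinear x : coact (T V) (AHom eta_ahom_subproof x) =
  tmap (AHom eta_ahom_subproof) idfun (coact NV x).
Proof.
have L := eta_linear.
apply: (tens_ext (L := fun x => coact (T V) (eta_fun x))
  (L' := fun x => tmap eta_fun idfun (coact NV x))); [slin | slin |].
move=> n v; rewrite etaE (coact_fun_orbit T_colinear H_projective) /= btens_coactE.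
rewrite [RHS]tlift_tmul; try by move=> ?; slin.
by apply: eq_tlift => n0 n1; apply: eq_tlift => v0 v1; rewrite etaE.
Qed.

Definition eta : HOM NV (T V) := Hom (colinear_HOM eta_colinear).

(** With 1 = \sum_q g_q(n_q), y is the sum of the g_q(n_q) y, and b |-> b y
    composed with g_q is a map T(A) -> T(V), hence of the form
    T(a |-> a v_q). *)
Lemma eta_onto (y : T V) : exists x, eta x = y.
Proof.
have fact (q : HOM N R * N) : exists v : V,
    fun_map T (orbit v) = HOM_comp (orbit y) q.1.
  have [f fE] := T_full (HOM_comp (orbit y) q.1 : hom (T (reg_rhm A)) (T V)).
  by exists (f (1 : A)); rewrite -HOM_orbit.
have {fact} [v vE] := choice fact.
exists (\sum_(q <- t) pure q.2 (v q)).
rewrite linear_sum -[RHS](act1 y) -t_trace (linsum (act_linear y)).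
by apply: eq_bigr => q _; rewrite /= etaE vE.
Qed.

(** Let x = \sum_p n_p ⊗ v_p. For g in HOM(N, B), the endomorphism
    n |-> g(n) n_p of N is right multiplication by some a_p. Then
    T(a |-> a \sum_p a_p v_p) sends n to g(n) eta(x) = 0, so
    \sum_p a_p v_p = 0. Expanding n_p = \sum_q g_q(n_q) n_p and moving the
    resulting elements of A across the tensor sign gives x = 0. *)
Lemma eta_ker (x : NV) : eta x = 0 -> x = 0.
Proof.
move=> ex.
have fact (q : (HOM N R * N) * N) : exists a : A,
    fun_map T (orbit (a : reg_rhm A)) = HOM_comp (orbit q.2) q.1.1.
  have [f fE] := T_full
    (HOM_comp (orbit q.2) q.1.1 : hom (T (reg_rhm A)) (T (reg_rhm A))).
  by exists (f (1 : A)); rewrite -HOM_orbit.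
have {fact} [a aE] := choice fact.
have LT W := fun_map_linear T_colinear (V := reg_rhm A) (W := W).
have kill (g : HOM N R * N) : \sum_(p <- repr x) act V (a (g, p.1)) p.2 = 0.
  rewrite -[LHS]orbit1 -[RHS](orbit1 (0 : V)); congr (HOM_ahom _ _).
  rewrite (lin0 (@orbit_linear _ _ A V)) (linsum (@orbit_linear _ _ A V)).
  apply: T_faithful; rewrite -[LHS]/(fun_map T _) -[RHS]/(fun_map T 0).
  rewrite (lin0 (LT V)) (linsum (LT V)).
  apply: HOM_eqP => n; transitivity (act (T V) (g.1 n : B) (eta x)); last first.
    by rewrite ex linear0.
  rewrite -[X in act _ _ X]/(\sum_(p <- repr x) fun_map T (orbit p.2) p.1).
  rewrite linear_sum.
  rewrite (linsum (lin_evH n (@lin_id _ _))); apply: eq_bigr => p _ /=.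
  rewrite -[orbit _](comp_orbit (orbit p.2) (a (g, p.1) : reg_rhm A)).
  by rewrite fun_map_comp aE /= -(ahomP (fun_map T _)).2.
rewrite (tens_sum x).
transitivity (\sum_(q <- t)
  pure q.2 (\sum_(p <- repr x) act V (a (q, p.1)) p.2)).
  under [RHS]eq_bigr do rewrite (linsum (tpure_lin_r _ _ _)).
  rewrite [RHS]exchange_big; apply: eq_bigr => p _.
  rewrite -{1}(act1 p.1) -t_trace (linsum (act_linear p.1)).
  rewrite (linsum (tpure_lin_l _ _ _)); apply: eq_bigr => q _.
  rewrite -tpure_bal; congr (pure _ _).
  exact/esym/(congr1 (fun f : HOM _ _ => f q.2) (aE (q, p.1))).
by rewrite big1 // => q _; rewrite kill (lin0 (tpure_lin_r _ _ _)).
Qed.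

Lemma eta_invertible : exists g : HOM (T V) NV,
  HOM_comp eta g = HOM_id (T V) /\ HOM_comp g eta = HOM_id NV.
Proof.
apply: colinear_bij_invertible; first exact: eta_colinear.
have [g gK] := choice eta_onto; exists g => // x.
apply/eqP; rewrite -subr_eq0; apply/eqP/eta_ker.
transitivity (eta (g (eta x)) - eta x); first exact: linearB.
by rewrite gK subrr.
Qed.
End Eta.

Lemma functor_iso_tensor : functor_iso T (tensor_functor N).
Proof.
apply: functor_iso_sym.
apply: (@functor_iso_of_invertible (HOMcat A) (HOMcat B) (tensor_functor N) T eta);
  last exact: eta_invertible.
move=> V W f; apply: HOM_eqP => x.
have LV := @eta_linear V; have LW := @eta_linear W.
apply: (tens_ext (L := fun x => eta_fun (btens_ahom N f x))
  (L' := fun x => fun_map T f (eta_fun x))); [slin | slin |].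
by move=> n v; rewrite btens_ahomE !etaE -fun_map_comp comp_orbit.
Qed.
End EilenbergWatts.

(** * Tensoring with both bimodules of a Morita context *)

Section TensorComposite.
Variables (k : comPzRingType) (H : hopfAlg k) (A B : comodAlg H).
Variable X : morita_context A B.
Local Notation M := (mc_M X).
Local Notation N := (mc_N X).
Local Notation alpha := (mc_alpha X).
Local Notation beta := (mc_beta X).
Local Notation pMN := (tpure (ract M) (act N)).
Local Notation pNM := (tpure (ract N) (act M)).

Section Eps.
Variable W : relHopfMod B.
Local Notation MW := (btens_rhm M W).
Local Notation NMW := (btens_rhm N MW).
Local Notation pMW := (tpure (ract M) (act W)).
Local Notation pNMW := (tpure (ract N) (act MW)).

Let beta_lin : linear beta := (bh_colinear beta).1.

Definition eps_inner (n : N) : MW -> W :=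
  tlift (fun m w => act W (beta (pNM n m) : B) w).

Lemma eps_inner_balanced n :
  balanced (ract M) (act W) (fun m w => act W (beta (pNM n m) : B) w).
Proof.
split=> [w|m|b m w]; [by slin | by slin |].
transitivity (act W (beta (ract (btens_bimod N M) b (pNM n m)) : B) w).
  congr (act W _ w); congr (bh_fun beta _).
  exact/esym/btens_ractE.
by rewrite bh_ract -actM.
Qed.

Lemma eps_innerE n m w : eps_inner n (pMW m w) = act W (beta (pNM n m) : B) w.
Proof. exact: tliftE (eps_inner_balanced n). Qed.

Lemma eps_inner_linear n : linear (eps_inner n).
Proof. exact: tlift_linear (eps_inner_balanced n). Qed.

Lemma eps_balanced : balanced (ract N) (act MW) eps_inner.
Proof.
split=> [x|n|a n x]; [|exact: eps_inner_linear|].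
  by apply: lin_tlift_f => m w; slin.
have L := eps_inner_linear.
apply: (tens_ext (L := eps_inner (ract N a n))
  (L' := fun x => eps_inner n (act MW a x))); [exact: L | |].
  by apply: lin_comp (L n) _; slin.
by move=> m w; rewrite /= btens_actE !eps_innerE tpure_bal.
Qed.

Definition eps_fun : NMW -> W := tlift eps_inner.
Lemma epsE n m w : eps_fun (pNMW n (pMW m w)) = act W (beta (pNM n m) : B) w.
Proof. by rewrite -eps_innerE; exact: tliftE eps_balanced. Qed.
Lemma eps_linear : linear eps_fun.
Proof. exact: tlift_linear eps_balanced. Qed.

Lemma tens2_ext (P : lmodType k) (L L' : NMW -> P) : linear L -> linear L' ->
  (forall n m w, L (pNMW n (pMW m w)) = L' (pNMW n (pMW m w))) -> L =1 L'.
Proof.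
move=> hL hL' E; apply: tens_ext => // n.
apply: (tens_ext (L := fun x => L (pNMW n x)) (L' := fun x => L' (pNMW n x))).
- by apply: lin_comp hL _; slin.
- by apply: lin_comp hL' _; slin.
exact: E.
Qed.

Fact eps_ahom_subproof : eps_fun \in ahom_pred NMW W.
Proof.
have L := eps_linear; apply/asboolP; split=> [u v|b x]; first exact: (linD L).
apply: (tens2_ext (L := fun x => eps_fun (act NMW b x))
  (L' := fun x => act W b (eps_fun x))); [slin | slin |].
move=> n m w; rewrite [act NMW b _]btens_actE !epsE -actM.
congr (act W _ w).
transitivity (beta (act (btens_bimod N M) b (pNM n m)) : B).
  by congr (bh_fun beta _); exact/esym/btens_actE.
exact: (bh_act beta b (pNM n m)).
Qed.

Lemma eps_colinear x : coact W (AHom eps_ahom_subproof x) =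
  tmap (AHom eps_ahom_subproof) idfun (coact NMW x).
Proof.
have L := eps_linear.
apply: (tens2_ext (L := fun x => coact W (eps_fun x))
  (L' := fun x => tmap eps_fun idfun (coact NMW x))); [slin | slin |].
move=> n m w; rewrite epsE coact_act.
rewrite [acoact B _]((bh_colinear beta).2 (pNM n m)).
rewrite [coact (btens_bimod N M) _]btens_coactE.
rewrite [LHS]tlift_tmap; try by move=> ?; slin.
rewrite [LHS]tlift_tmul; try by move=> ?; slin.
rewrite [coact NMW _]btens_coactE.
rewrite [RHS]tlift_tmul; try by move=> ?; slin.
apply: eq_tlift => n0 n1.
rewrite [coact MW _]btens_coactE.
rewrite [RHS]tlift_tmul; try by move=> ?; slin.
apply: eq_tlift => m0 m1; apply: eq_tlift => w0 w1.
by rewrite epsE /kmul mulrA.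
Qed.

Definition eps : HOM NMW W := Hom (colinear_HOM eps_colinear).

Variable u : btens N M.
Hypothesis beta_u : beta u = (1 : B).

(* w = 1 w = beta(u) w is the image of u tensored with w. *)
Let eps_inv (w : W) : NMW := tlift (fun n m => pNMW n (pMW m w)) u.

Lemma eps_bij : bijective eps.
Proof.
have L := eps_linear.
exists eps_inv; last first.
  move=> w; rewrite -[LHS]/(eps_fun (eps_inv w)) /eps_inv.
  rewrite (linear_tlift (L := eps_fun)) //.
  rewrite -[RHS](act1 w) -beta_u {2}(tens_sum u) (linsum beta_lin).
  rewrite (linsum (act_linear w)).
  by apply: eq_bigr => p _; rewrite epsE.
apply: (tens2_ext (L := fun x => eps_inv (eps_fun x)) (L' := id)) => //.
  by rewrite /eps_inv; slin.
move=> n m w; rewrite epsE /eps_inv.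
transitivity (tlift (fun n' m' =>
  pNMW (act N (beta (pNM n' m') : B) n) (pMW m w)) u).
  apply: eq_tlift => n' m'.
  rewrite mc_betaP tpure_bal; congr (pNMW n' _).
  by rewrite -tpure_bal -mc_alphaP; exact/esym/btens_actE.
rewrite -[in RHS](act1 n) -beta_u {2}(tens_sum u) (linsum beta_lin).
by rewrite (linsum (act_linear n)) (linsum (tpure_lin_l _ _ _)).
Qed.
End Eps.

(** The map n ⊗ (m ⊗ w) |-> beta(n ⊗ m) w is a natural isomorphism; the two
    associativity laws of the context make its one-sided inverse two-sided. *)
Lemma tensor_composite : (exists u, beta u = (1 : B)) ->
  functor_iso (functor_comp (tensor_functor N) (tensor_functor M))
    (functor_id (HOMcat B)).
Proof.
move=> [u beta_u].
apply: (@functor_iso_of_invertible (HOMcat B) (HOMcat B)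
  (functor_comp (tensor_functor N) (tensor_functor M))
  (functor_id (HOMcat B)) eps).
  move=> V W f; apply: HOM_eqP => x.
  have LV := @eps_linear V; have LW := @eps_linear W.
  apply: (tens2_ext (L := fun x => eps_fun (btens_ahom N (btens_HOM M f) x))
    (L' := fun x => f (eps_fun x))); [slin | slin |].
  by move=> n m v; rewrite !btens_ahomE !epsE (ahomP f).2.
move=> W; apply: (@colinear_bij_invertible _ _ _ _ _ (eps W)).
  exact: eps_colinear.
exact: eps_bij beta_u.
Qed.
End TensorComposite.

(** * The equivalence *)

Section ImageOfRegular.
Variables (k : comPzRingType) (H : hopfAlg k) (A B : comodAlg H).
Hypothesis H_projective : projective H.
Variables (T : functor (HOMcat A) (HOMcat B)) (U : functor (HOMcat B) (HOMcat A)).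
Hypothesis TU_equiv : inverse_equivalences T U.
Hypotheses (T_colinear : colinear_functor T) (U_colinear : colinear_functor U).
Local Notation N := (fun_bimod T_colinear H_projective).
Local Notation R := (reg_rhm B).

Lemma inverse_faithful_full : [/\ faithful T, full T, faithful U & full U].
Proof.
have [UT TU] := TU_equiv.
have fT := equivalence_faithful UT; have fU := equivalence_faithful TU.
by split=> //; [exact: equivalence_full UT fU | exact: equivalence_full TU fT].
Qed.

(** [trace_full] for U, since U(T(A)) is isomorphic to A. *)
Lemma image_generator :
  exists t : seq (HOM N R * N), \sum_(q <- t) q.1 q.2 = (1 : B).
Proof.
have [fT uT fU uU] := inverse_faithful_full.
have [[phi [psi [_ phiK _]]] _] := TU_equiv.
exact: (trace_full H_projective U_colinear fU uU (phiK (reg_rhm A))).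
Qed.

(** [trace_full] for T yields 1 = \sum_q f_q(m_q) in A, with f_q : U(B) -> A.
    So the identity of A is the sum of the composites A -> U(B) -> A of
    a |-> a m_q and f_q. Applying T, and replacing T(U(B)) by B, shows that the
    identity of N is a finite sum of composites N -> B -> N. *)
Lemma image_dual_basis : exists s : seq (HOM N R * N),
  forall n, n = \sum_(q <- s) act N (q.1 n : B) q.2.
Proof.
have [fT uT fU uU] := inverse_faithful_full.
have [_ [phi [psi [_ phiK psiK]]]] := TU_equiv.
pose i : HOM (T (U R)) R := phi R; pose j : HOM R (T (U R)) := psi R.
have jK y : j (i y) = y.
  exact: (congr1 (fun f : HOM (T (U R)) (T (U R)) => f y) (psiK R)).
have [t t1] := trace_full H_projective T_colinear fT uT (phiK R).
exists [seq (HOM_comp i (fun_map T (orbit q.2)),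
             fun_map T q.1 (j (1 : B))) | q <- t].
move=> n; rewrite big_map /= -{1}(fun_map_id n).
have -> : HOM_id (reg_rhm A) = \sum_(q <- t) HOM_comp q.1 (orbit q.2).
  rewrite [LHS]HOM_orbit -[HOM_id _ _]t1.
  rewrite (linsum (@orbit_linear _ _ A (reg_rhm A))).
  by apply: eq_bigr => q _; rewrite comp_orbit.
have LT V W := fun_map_linear T_colinear (V := V) (W := W).
rewrite (linsum (LT _ _)) (linsum (lin_evH n (@lin_id _ _))).
apply: eq_bigr => q _; rewrite fun_map_comp -{1}(jK (fun_map T _ n)).
rewrite -(ahomP (fun_map T q.1)).2 -(ahomP j).2; congr (fun_map T q.1 (j _)).
exact/esym/mulr1.
Qed.
End ImageOfRegular.

Theorem corollary8p5 (k : comPzRingType) (H : hopfAlg k)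
    (H_projective : projective H)
    (A B : comodAlg H) (A_galois : is_galois A) (B_galois : is_galois B)
    (T : functor (HOMcat A) (HOMcat B)) (U : functor (HOMcat B) (HOMcat A))
    (TU_equiv : inverse_equivalences T U)
    (T_colinear : colinear_functor T) (U_colinear : colinear_functor U) :
  exists X : morita_context A B,
    [/\ strict X,
        functor_iso T (tensor_functor (mc_N X)) &
        functor_iso U (tensor_functor (mc_M X))].
Proof.
have [T_faithful T_full _ _] := inverse_faithful_full TU_equiv.
pose N : bimod B A := fun_bimod T_colinear H_projective.
have [s s_dual] := image_dual_basis H_projective TU_equiv T_colinear.
have [t t_trace] :=
  image_generator H_projective TU_equiv T_colinear U_colinear.
pose forget (q : HOM N (reg_rhm B) * N) := (q.1 : ahom N (reg_rhm B), q.2).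
have s_dual' n : n = \sum_(q <- map forget s) act N (q.1 n : B) q.2.
  by rewrite big_map.
have t_trace' : \sum_(q <- map forget t) q.1 q.2 = (1 : B) by rewrite big_map.
(* Every B-linear map out of N is a finite sum of composites N -> B -> W of
   maps in HOM, hence lies in HOM itself. *)
have factor (W : relHopfMod B) (f : ahom N W) : f \in HOM_pred N W.
  rewrite (_ : f = \sum_(q <- s) acomp (orbit_ahom (f q.2)) q.1).
    by apply: rpred_sum => q _; exact: (HOM_comp_subproof (orbit (f q.2)) q.1).
  apply: ahom_eqP => n.
  rewrite (linsum (@ev_linear _ _ _ N W n)) {1}(s_dual n) linear_sum.
  by apply: eq_bigr => q _; exact: (ahomP f).2.
have ract_onto (f : ahom N N) : exists a, forall n, f n = ract N a n.
  have [g gE] := T_full _ _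
    (Hom (factor N f) : hom (T (reg_rhm A)) (T (reg_rhm A))).
  exists (g (1 : A)) => n; rewrite /= /fun_ract -HOM_orbit.
  exact: (congr1 (fun f : HOM N N => f n) (esym gE)).
have ract_faithful a : (forall n, ract N a n = 0) -> a = 0.
  move=> a0; rewrite -(orbit1 (a : reg_rhm A)).
  rewrite (_ : orbit _ = 0) //; apply: T_faithful.
  have LT := fun_map_linear T_colinear (V := reg_rhm A) (W := reg_rhm A).
  rewrite -[RHS]/(fun_map T 0) (lin0 LT).
  by apply: HOM_eqP => n; exact: a0.
pose X := morita s_dual' (factor _) ract_onto ract_faithful.
have X_strict : strict X by exact: morita_strict t_trace' _ _ _.
have TN : functor_iso T (tensor_functor (mc_N X)).
  exact: (functor_iso_tensor T_faithful T_full (H_projective := H_projective)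
    (T_colinear := T_colinear) t_trace).
exists X; split=> //.
(* T is cancelled from the isomorphisms between T U, the identity and
   N ⊗_A (M ⊗_B -), the last of which is T (M ⊗_B -). *)
apply: (functor_iso_cancel T_faithful T_full).
apply: functor_iso_trans TU_equiv.2 _; apply: functor_iso_sym.
apply: functor_iso_trans (functor_iso_comp_l (tensor_functor (mc_M X)) TN) _.
have [_ [b _ bK]] := X_strict.
by apply: tensor_composite; exists (b (1 : B)); exact: bK.
Qed.
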